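(* Let $F:\mathbb{R}\to[0,\infty)$ satisfy (F1)--(F4), let $0\le f\le1$ on $[0,1]$, let $\lambda>0$, and let $u\in BV(0,1)$ be the unique minimizer of $K$ in $BV(0,1)$. If the data function $f$ is globally Lipschitz continuous on $[0,1]$, then $u\in C^2([0,1])$.
   Context: Conditions on $F:\mathbb{R}\to[0,\infty)$ (for all $p\in\mathbb{R}$, with constants $\nu_1,\nu_2>0$, $\nu_3\in\mathbb{R}$): (F1) $F\in C^2(\mathbb{R})$, $F(-p)=F(p)$, $F(0)=0$; (F2) $|F'(p)|\le\nu_1$; (F3) $F(p)\ge\nu_2|p|-\nu_3$; (F4) $F''(p)>0$. Set $\lambda_\infty=\lambda_\infty(F):=\lim_{p\to\infty}F'(p)$, a positive number. For $w\in BV(0,1)$ write the distributional derivative as $Dw=\dot w\,\mathcal{L}^1+D^sw$ (Lebesgue decomposition with respect to Lebesgue measure $\mathcal{L}^1$; $\dot w$ is the density of the absolutely continuous part and $D^sw$ the singular part, $|D^sw|$ its total variation measure), and $$K[w]:=\int_0^1F(\dot w)\,dt+\lambda_\infty|D^sw|(0,1)+\frac{\lambda}{2}\int_0^1(w-f)^2\,dt.$$ Under (F1)--(F4), $K$ has a unique minimizer in $BV(0,1)$. Every $BV$-function is identified with its good representative, which is continuous outside an at most countable set of jump points and has left and right limits at all points. *)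

(* Defs.v *)
From mathcomp Require Import all_boot all_order all_algebra.
From mathcomp Require Import all_classical all_reals all_analysis.

Set Implicit Arguments.
Unset Strict Implicit.
Unset Printing Implicit Defensive.

Import Order.TTheory GRing.Theory Num.Theory.
Import numFieldNormedType.Exports.

Local Open Scope classical_set_scope.
Local Open Scope ring_scope.

Section choice.
Context {T : Type}.

Definition choose_or (P : set T) (x0 : T) : T :=
  match pselect (exists x, P x) with
  | left exP => sval (cid exP)
  | right _ => x0
  end.

End choice.

(* The positive, negative and total variations of a charge do not depend on
   the chosen Hahn decomposition, by [Hahn_decomposition_uniq]. *)
Section charge_parts.
Context d (T : measurableType d) (R : realType).
Variable nu : {charge set T -> \bar R}.

Definition hahn_pos : set T := sval (cid (Hahn_decomposition nu)).

Definition hahn_neg : set T :=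
  sval (cid (svalP (cid (Hahn_decomposition nu)))).

Definition hahn_posneg : hahn_decomposition nu hahn_pos hahn_neg :=
  svalP (cid (svalP (cid (Hahn_decomposition nu)))).

Definition total_var : set T -> \bar R := charge_variation hahn_posneg.

Definition charge_Rintegral (D : set T) (phi : T -> R) : R :=
  \int[jordan_pos hahn_posneg]_(x in D) phi x
  - \int[jordan_neg hahn_posneg]_(x in D) phi x.

End charge_parts.

(* A finite signed Borel measure on (0,1) is represented by a charge on the
   line of which only the values on Borel subsets of `]0, 1[ are ever used. *)
Section BV.
Context {R : realType}.
Implicit Types (w g phi : R -> R)
  (mu nu : {charge set (measurableTypeR R) -> \bar R}).

Local Notation leb := (@lebesgue_measure R).
Local Notation I01 := (`]0%R, 1%R[%classic : set R).

Definition C1_compact_support phi : Prop :=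
  [/\ (forall x, derivable phi x 1),
      continuous (phi^`()%classic),
      compact (closure [set x | phi x != 0]) &
      closure [set x | phi x != 0] `<=` I01].

(* Testing with C^1_c instead of C^oo_c functions makes no difference when the
   derivative is a measure. *)
Definition is_distr_derivative w mu : Prop :=
  forall phi, C1_compact_support phi ->
    \int[leb]_(x in I01) (w x * phi^`()%classic x) = - charge_Rintegral mu I01 phi.

Definition BV01 w : Prop :=
  leb.-integrable I01 (EFin \o w) /\ exists mu, is_distr_derivative w mu.

Definition distr_derivative w : {charge set (measurableTypeR R) -> \bar R} :=
  choose_or [set mu | is_distr_derivative w mu] czero.

Definition singular01 nu : Prop :=
  exists2 N : set (measurableTypeR R), measurable N /\ leb N = 0%E &
    total_var nu (I01 `\` N) = 0%E.

Definition is_lebesgue_decomposition mu g nu : Prop :=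
  [/\ leb.-integrable I01 (EFin \o g),
      singular01 nu &
      forall A : set (measurableTypeR R), measurable A -> A `<=` I01 ->
        mu A = (\int[leb]_(x in A) (g x)%:E + nu A)%E].

Definition lebesgue_decomposition mu :
    (R -> R) * {charge set (measurableTypeR R) -> \bar R} :=
  choose_or [set p | is_lebesgue_decomposition mu p.1 p.2]
    (cst 0, (czero : {charge set (measurableTypeR R) -> \bar R})).

Definition ac_density w : R -> R :=
  (lebesgue_decomposition (distr_derivative w)).1.

Definition singular_part w : {charge set (measurableTypeR R) -> \bar R} :=
  (lebesgue_decomposition (distr_derivative w)).2.

(* Right-continuity at 0 and left-continuity at 1 express that the boundary
   values of the good representative are its one-sided limits. *)
Definition good_representative w : Prop :=
  [/\ (forall x, I01 x ->
         cvg (w y @[y --> x^'-]) /\ cvg (w y @[y --> x^'+])),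
      (w y @[y --> 0^'+] --> w 0),
      (w y @[y --> 1^'-] --> w 1),
      countable [set x | I01 x /\ ~ {for x, continuous w}] &
      (forall x, I01 x -> ~ {for x, continuous w} ->
         lim (w y @[y --> x^'-]) <> lim (w y @[y --> x^'+]))].

(* One-sided derivatives at the endpoints. *)
Definition derivative_on_01 w g : Prop :=
  forall x, x \in `[0, 1] ->
    (w y - w x) / (y - x) @[y --> within `[0, 1]%classic x^'] --> g x.

Definition C2_on_01 w : Prop :=
  exists w1 w2 : R -> R,
    [/\ derivative_on_01 w w1,
        derivative_on_01 w1 w2 &
        {within `[0, 1]%classic, continuous w2}].

End BV.

Section energy.
Context {R : realType}.
Implicit Types (F f w : R -> R).

Local Notation leb := (@lebesgue_measure R).
Local Notation I01 := (`]0%R, 1%R[%classic : set R).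

Definition condF1 F : Prop :=
  [/\ (forall p, derivable F p 1) /\ (forall p, derivable F^`()%classic p 1),
      continuous (F^`(2)%classic),
      forall p, F (- p) = F p &
      F 0 = 0].

Definition condF2 F (nu1 : R) : Prop := forall p, `|F^`()%classic p| <= nu1.

Definition condF3 F (nu2 nu3 : R) : Prop := forall p, nu2 * `|p| - nu3 <= F p.

Definition condF4 F : Prop := forall p, 0 < F^`(2)%classic p.

Definition lambda_infty F : R := lim (F^`()%classic p @[p --> +oo]).

(* Both chosen objects are unique on `]0, 1[ when [BV01 w] (the density almost
   everywhere), so that the value does not depend on the choice; it is
   meaningless otherwise. *)
Definition K F f (lambda : R) w : \bar R :=
  (\int[leb]_(t in I01) (F (ac_density w t))%:E
   + (lambda_infty F)%:E * total_var (singular_part w) I01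
   + (lambda / 2)%:E * \int[leb]_(t in I01) ((w t - f t) ^+ 2)%:E)%E.

Definition minimizer_BV01 F f (lambda : R) u : Prop :=
  BV01 u /\ forall w, BV01 w -> (K F f lambda u <= K F f lambda w)%E.

End energy.

(* Main.v *)
Require Import Defs.
From mathcomp Require Import all_boot all_order all_algebra.
From mathcomp Require Import all_classical all_reals all_analysis.
From mathcomp Require Import measurable_realfun ring lra.
Import Order.TTheory GRing.Theory Num.Theory.
Import numFieldNormedType.Exports.
Local Open Scope classical_set_scope.
Local Open Scope ring_scope.
Set Implicit Arguments.
Unset Strict Implicit.
Unset Printing Implicit Defensive.

(** The regularity of the minimizer is obtained without analysing the minimizer
itself: a smooth solution of the Euler equation is constructed, shown to
minimize [K] with a quadratic gap, and then identified with [u].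

The Euler equation of [K] is the Neumann problem for the system
[v' = (F')^-1(s)], [s' = lambda (v - f)], [s(0) = s(1) = 0].  As [F'] is only
invertible onto the interval between [- lambda_infty] and [lambda_infty], it is
first inverted on [[-M, M]] only, with [M] larger than the Lipschitz constant
of [f], and extended by constants.  The truncated system is globally Lipschitz,
hence solvable by Picard iteration for every initial value [v(0) = a] with
[s(0) = 0]; a bounded slope makes [s(1)] nonpositive for small [a] and
nonnegative for large [a], and the intermediate value theorem yields [a] with
[s(1) = 0] ([shooting]).  The truncation is never active: if [s] had a maximum
with value at least [F'(M)] at a point [c], then [v = f] at [c] while
[v' = M > Lip f] there, so that [v > f] and thus [s' > 0] to the right of [c]
([max_principle]).  Hence [s = F'(v')] with [v'] bounded, and solving for [v']
shows that [v] is of class C2 ([euler_bvp]).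

For [w] in BV with [Dw = g dx + nu], convexity of [F] gives
[F(g) >= F(v') + s (g - v')], and [lambda_infty |nu| >= \int s dnu] since
[|s| = |F'(v')| <= lambda_infty].  The sum of [\int s g] and [\int s dnu] is
[\int s dDw], which equals [- \int w s'] because [s] vanishes at both ends
([distr_derivative_prim]).  With [s' = lambda (v - f)] the linear terms cancel
against those of the fidelity term, and [K w >= K v + lambda/2 \int (w - v)^2]
follows.  For the minimizer [u] this forces [u = v] almost everywhere on (0,1)
([minimizer_eq]), and the good representative of a function that is almost
everywhere equal to a continuous one is that continuous one
([good_representative_eq]).

The functional is written in terms of a chosen distributional derivative and a
chosen Lebesgue decomposition.  To evaluate it, a charge on (0,1) is shown to be
determined by its integrals of C1 test functions ([charge_eq_of_test]), and the
Lebesgue decomposition is shown to exist ([lebesgue_decomposition_exists]) and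
to be the expected one when the derivative has an integrable density
([lebesgue_decomposition_unique]). *)

(** * Derivatives, clamping and primitives *)

Section ode.
Context {R : realType}.
Implicit Types (f g df dg G s : R -> R) (a b c lo hi x y t : R).
Local Notation leb := (@lebesgue_measure R).

Lemma is_derive_continuous f df :
  (forall x, is_derive x 1 f (df x)) -> continuous f.
Proof.
move=> fd x; apply/differentiable_continuous/derivable1_diffP.
by case: (fd x).
Qed.

Lemma is_derive_derive1 f df :
  (forall x, is_derive x 1 f (df x)) -> f^`()%classic = df.
Proof. by move=> fd; apply/funext => x; rewrite derive1E; apply: derive_val. Qed.

(** Primitives of continuous functions are estimated by comparing derivatives
through this lemma, which spares the theory of the integral. *)
Lemma le_increment f df g dg a b :
  (forall x, is_derive x 1 f (df x)) -> (forall x, is_derive x 1 g (dg x)) ->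
  a <= b -> (forall x, x \in `[a, b] -> df x <= dg x) -> f b - f a <= g b - g a.
Proof.
move=> fd gd ab dfg.
have hd x : is_derive x 1 (g - f) (dg x - df x) by exact: is_deriveB.
have [c cab] := MVT_segment ab (fun x _ => hd x)
  (continuous_subspaceT (is_derive_continuous hd)).
rewrite !fctE => E; rewrite -subr_ge0.
have -> : g b - g a - (f b - f a) = g b - f b - (g a - f a) by ring.
by rewrite E mulr_ge0// subr_ge0// dfg.
Qed.

Lemma is_derive_mull c x : is_derive x 1 (fun y : R => c * y) c.
Proof.
by rewrite -[X in is_derive _ _ _ X]mulr1; exact: (@is_deriveZ _ _ _ id c).
Qed.

Definition clamp lo hi x : R := Num.max lo (Num.min hi x).

Lemma clamp_itv lo hi x : lo <= hi -> lo <= clamp lo hi x <= hi.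
Proof. by move=> lohi; rewrite /clamp le_max lexx/= ge_max lohi ge_min lexx. Qed.

Lemma clamp_id lo hi x : lo <= x <= hi -> clamp lo hi x = x.
Proof. by move=> /andP[x0 x1]; rewrite /clamp min_r// max_r. Qed.

Lemma clamp_lipschitz lo hi x y : lo <= hi ->
  `|clamp lo hi x - clamp lo hi y| <= `|x - y|.
Proof.
move=> lohi; wlog xy : x y / x <= y.
  by move=> h; case: (leP x y) => [|/ltW] ? ; [exact: h|rewrite distrC (distrC x); exact: h].
rewrite distrC (distrC x) (ger0_norm (_ : 0 <= y - x)) ?subr_ge0//.
have h1 : clamp lo hi x <= clamp lo hi y.
  by rewrite /clamp ge_max le_max lexx/= le_max le_min !ge_min lexx xy !orbT.
rewrite ger0_norm ?subr_ge0//.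
rewrite /clamp /Num.max /Num.min.
by move: lohi xy; repeat case: ifPn; rewrite -?leNgt; move=> *; lra.
Qed.

Lemma clamp_continuous lo hi : continuous (clamp lo hi).
Proof.
by move=> x; exact: (continuous_max (cvg_cst _) (continuous_min (cvg_cst _) (@cvg_id _ _))).
Qed.

Lemma clamp01P x : clamp 0 1 x \in `[0, 1].
Proof. by rewrite in_itv/= clamp_itv. Qed.

Lemma clamp01_id x : x \in `[0, 1] -> clamp 0 1 x = x.
Proof. by rewrite in_itv/=; exact: clamp_id. Qed.

(** A continuous cutoff equal to 1 on [0,1] and to 0 outside [-2,2]. *)
Definition plateau (x : R) : R := Num.max 0 (Num.min 1 (2 - `|x|)).

(** The integrand is cut off so that it is integrable on every half line; this
makes [prim g] differentiable on the whole line, with derivative [g] on [0,1],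
and no one-sided derivatives are needed. *)
Definition prim g (x : R) : R :=
  \int[leb]_(t in [set` `]-oo, x]]) (plateau t * g t)
  - \int[leb]_(t in [set` `]-oo, 0%R]]) (plateau t * g t).

Lemma plateau1 x : x \in `[0, 1] -> plateau x = 1.
Proof.
rewrite in_itv/= => /andP[x0 x1]; rewrite /plateau ger0_norm// min_l; last lra.
by rewrite max_r.
Qed.

Lemma plateau_continuous : continuous plateau.
Proof.
move=> x.
have c1 : {for x, continuous (fun t : R => 2 - `|t|)}.
  by apply: cvgB; [exact: cvg_cst|exact: norm_continuous].
exact: (continuous_max (cvg_cst _) (continuous_min (cvg_cst _) c1)).
Qed.

Lemma prim0 g : prim g 0 = 0.
Proof. exact: subrr. Qed.

Lemma is_derive_prim g : continuous g ->
  forall x, is_derive x 1 (prim g) (plateau x * g x).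
Proof.
move=> cg x.
have ch : continuous (fun t => plateau t * g t).
  by move=> t; apply: cvgM; [exact: plateau_continuous|exact: cg].
have ih u : leb.-integrable [set` `]-oo, u]] (EFin \o (fun t => plateau t * g t)).
  have : leb.-integrable `[-2, 2]%classic (EFin \o (fun t => plateau t * g t)).
    apply: continuous_compact_integrable; first exact: segment_compact.
    exact: continuous_subspaceT.
  move=> /(integrable_mkcond _ _).1 => /(_ (measurable_itv _)) ih.
  apply: (@integrableS _ _ _ _ setT) => //.
  move: ih; congr (integrable _ _ _); apply/funext => t.
  rewrite patchE; case: ifPn => //; rewrite notin_setE/= in_itv/= => nt.
  rewrite /plateau max_l ?mul0r// ge_min; apply/orP; right.
  rewrite subr_le0; move: nt; apply: contra_notT; rewrite -ltNge => /ltW.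
  by rewrite ler_norml.
have xx1 : x < x + 1 by rewrite ltrDl.
have [d1 d2] := continuous_FTC1 xx1 (ih (x + 1)) (ltNyr _) (ch x).
have D1 : is_derive x 1 (fun x0 : R => \int[leb]_(t in [set` `]-oo, x0]]) (plateau t * g t)) (plateau x * g x).
  by apply: DeriveDef => //; rewrite -derive1E.
rewrite -[X in is_derive _ _ _ X]subr0.
exact: is_deriveB.
Qed.

Lemma is_derive_add_prim c g : continuous g ->
  forall x, is_derive x 1 (fun t => c + prim g t) (plateau x * g x).
Proof.
move=> cg x; rewrite -[X in is_derive _ _ _ X]add0r.
have d := is_derive_prim cg x.
exact: (@is_deriveD _ _ _ (cst c) (prim g)).
Qed.

End ode.

(** * Picard iteration in a weighted supremum norm *)
Section picard.
Context {R : realType}.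
Implicit Types (f g df dg s : R -> R) (a b x y t : R).

Lemma prim_continuous g : continuous g -> continuous (prim g).
Proof. by move=> cg; exact: is_derive_continuous (is_derive_prim cg). Qed.

Lemma le_prim_increment g f df a b : continuous g ->
  (forall x, is_derive x 1 f (df x)) ->
  0 <= a -> a <= b -> b <= 1 -> (forall x, x \in `[a, b] -> g x <= df x) ->
  prim g b - prim g a <= f b - f a.
Proof.
move=> cg fd a0 ab b1 gf; apply: (le_increment (is_derive_prim cg) fd ab) => x xab.
rewrite plateau1 ?mul1r ?gf//.
by move: xab; rewrite !in_itv/= => /andP[? ?]; apply/andP; split; lra.
Qed.

Lemma ge_prim_increment g f df a b : continuous g ->
  (forall x, is_derive x 1 f (df x)) ->
  0 <= a -> a <= b -> b <= 1 -> (forall x, x \in `[a, b] -> df x <= g x) ->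
  f b - f a <= prim g b - prim g a.
Proof.
move=> cg fd a0 ab b1 gf; apply: (le_increment fd (is_derive_prim cg) ab) => x xab.
rewrite plateau1 ?mul1r ?gf//.
by move: xab; rewrite !in_itv/= => /andP[? ?]; apply/andP; split; lra.
Qed.

(** Bounds relative to [weight k] are bounds in Bielecki's norm, in which an
integration gains the factor [k^-1]; for [k] large a Lipschitz integral operator
is then a contraction on all of [0,1]. *)
Definition weight (k t : R) : R := expR (k * t).

Lemma weight_gt0 k t : 0 < weight k t. Proof. exact: expR_gt0. Qed.

Lemma weight_ge1 k t : 0 <= k -> 0 <= t -> 1 <= weight k t.
Proof. by move=> k0 t0; rewrite -expR0 ler_expR mulr_ge0. Qed.

Lemma is_derive_weight k x : is_derive x 1 (weight k) (k * weight k x).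
Proof.
have d1 := is_derive_mull k x.
rewrite mulrC.
exact: (@is_derive1_comp _ expR (fun t => k * t)).
Qed.

Lemma is_derive_scaled_weight k c x :
  is_derive x 1 (fun t => c * weight k t) (c * (k * weight k x)).
Proof. exact: (@is_deriveZ _ _ _ (weight k) c _ _ _ (is_derive_weight k x)). Qed.

Lemma weight_continuous k : continuous (weight k).
Proof. exact: is_derive_continuous (is_derive_weight k). Qed.

Lemma primB g1 g2 t : continuous g1 -> continuous g2 ->
  prim g1 t - prim g2 t = prim (g1 \- g2) t.
Proof.
move=> c1 c2.
have c12 : continuous (g1 \- g2) by move=> x; apply: cvgB; [exact: c1|exact: c2].
have d x : is_derive x 1 (prim g1 - prim g2 - prim (g1 \- g2)) 0.
  have h := is_deriveB (is_deriveB (is_derive_prim c1 x) (is_derive_prim c2 x)) (is_derive_prim c12 x).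
  by apply: (is_derive_eq h) => /=; ring.
have := is_derive_0_is_cst t 0 d; rewrite !fctE !prim0 !subr0 => /eqP.
by rewrite subr_eq0 => /eqP.
Qed.

Lemma prim_weight_le k A g : 0 < k -> 0 <= A -> continuous g ->
  (forall t, t \in `[0, 1] -> `|g t| <= A * weight k t) ->
  forall t, t \in `[0, 1] -> `|prim g t| <= A / k * weight k t.
Proof.
move=> k0 A0 cg gA t t01; have := t01; rewrite in_itv/= => /andP[t0 t1].
have Ak : A / k * k = A by rewrite divfK// gt_eqF.
have Ak0 : 0 <= A / k by rewrite divr_ge0// ltW.
have sub01 x : x \in `[0, t] -> x \in `[0, 1].
  by rewrite !in_itv/= => /andP[-> /= h]; exact: le_trans h t1.
have h1 : prim g t - prim g 0 <= A / k * weight k t - A / k * weight k 0.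
  apply: (le_prim_increment cg (is_derive_scaled_weight k (A / k))) => // x /sub01 /gA.
  by rewrite mulrA Ak; apply: le_trans; exact: ler_norm.
have h2 : - (A / k) * weight k t - - (A / k) * weight k 0 <= prim g t - prim g 0.
  apply: (ge_prim_increment cg (is_derive_scaled_weight k (- (A / k)))) => // x /sub01 /gA.
  rewrite mulrA mulNr Ak mulNr => h; rewrite lerNl; apply: le_trans h.
  by rewrite -normrN ler_norm.
have w0 : 0 <= A / k * weight k 0 by rewrite mulr_ge0// ltW// weight_gt0.
move: h1 h2; rewrite prim0 subr0 => h1 h2; rewrite ler_norml; apply/andP; split; lra.
Qed.

(** Banach's fixed point theorem for Bielecki's norm on the continuous functions
on [0,1]. The limit of the iterates is precomposed with [clamp 0 1] so as to be
continuous on the line. *)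
Lemma weighted_fixpoint (T : (R -> R) -> R -> R) (k : R) : 0 <= k ->
  (forall s, continuous s -> continuous (T s)) ->
  (forall s1 s2 (A : R), continuous s1 -> continuous s2 -> 0 <= A ->
     (forall t, t \in `[0, 1] -> `|s1 t - s2 t| <= A * weight k t) ->
     forall t, t \in `[0, 1] -> `|T s1 t - T s2 t| <= A / 2 * weight k t) ->
  exists s, continuous s /\ forall t, t \in `[0, 1] -> s t = T s t.
Proof.
move=> k0 Tc Tcontr.
pose u n := iter n T (cst 0).
have uc n : continuous (u n).
  by elim: n => [|n ih]; [exact: cst_continuous|exact: Tc].
have [c c01 cmax] := @EVT_max R (fun t => `|u 1%N t - u 0%N t|) 0 1 ler01
  (continuous_subspaceT (fun x => cvg_norm (cvgB (@uc 1%N x) (@uc 0%N x)))).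
pose A : R := `|u 1%N c - u 0%N c|.
have A0 : 0 <= A by exact: normr_ge0.
have p2 n : 0 <= 2 ^+ n :> R by rewrite exprn_ge0.
have du n t : t \in `[0, 1] -> `|u n.+1 t - u n t| <= A / 2 ^+ n * weight k t.
  elim: n t => [|n ih] t t01.
    rewrite expr0 divr1; apply: le_trans (cmax t t01) _.
    rewrite -[leLHS]mulr1; apply: (ler_wpM2l A0); apply: weight_ge1 => //.
    by move: t01; rewrite in_itv/= => /andP[].
  have := Tcontr _ _ _ (uc n.+1) (uc n) (divr_ge0 A0 (p2 n)) ih t t01.
  by rewrite exprSr invfM mulrA.
pose W := weight k 1.
have wW t : t \in `[0, 1] -> weight k t <= W.
  rewrite in_itv/= => /andP[t0 t1].
  by rewrite ler_expR ler_wpM2l.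
have W0 : 0 < W by exact: weight_gt0.
have An n : 0 <= 2 * A / 2 ^+ n by rewrite divr_ge0 ?mulr_ge0.
(* geometric series: the iterates are uniformly Cauchy *)
have dmn n m t : t \in `[0, 1] -> `|u (n + m)%N t - u n t| <= 2 * A / 2 ^+ n * weight k t.
  move=> t01.
  suff : `|u (n + m)%N t - u n t| <= 2 * A / 2 ^+ n * (1 - 2 ^- m) * weight k t.
    move/le_trans; apply; apply: (ler_wpM2r (ltW (weight_gt0 k t))).
    rewrite -[leRHS]mulr1; apply: (ler_wpM2l (An n)).
    by rewrite gerBl invr_ge0 p2.
  elim: m => [|m ih]; first by rewrite addn0 !subrr normr0 expr0 invr1 subrr mulr0 mul0r.
  rewrite addnS; have := du (n + m)%N t t01.
  have -> : A / 2 ^+ (n + m) = 2 * A / 2 ^+ n * (2 ^- m - 2 ^- m.+1).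
    rewrite exprD exprS !invfM; field.
    by rewrite !expf_neq0.
  move=> h; have := lerD h ih; rewrite -mulrDl -mulrDr.
  have -> : 2 ^- m - 2 ^- m.+1 + (1 - 2 ^- m) = 1 - 2 ^- m.+1 :> R by ring.
  apply: le_trans; rewrite -[in leLHS](subrKA (u (n + m)%N t)).
  exact: ler_normD.
have half_small (e : R) : 0 < e -> exists n, 2 * A / 2 ^+ n * W < e.
  move=> e0.
  have : (2 * A * W) * 2^-1 ^+ n @[n --> \oo] --> (2 * A * W) * 0.
    by apply: cvgMr; apply: cvg_expr; rewrite ger0_norm// invf_lt1// ltr1n.
  rewrite mulr0 => /cvgr0Pnorm_lt /(_ _ e0) [N _ /(_ N (leqnn N))] /=.
  move=> h; exists N; apply: le_lt_trans h; rewrite exprVn.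
  rewrite (_ : 2 * A / 2 ^+ N * W = 2 * A * W / 2 ^+ N); first exact: ler_norm.
  by rewrite mulrAC.
have cu t : t \in `[0, 1] -> cvgn (fun n => u n t).
  move=> t01; apply: cauchy_cvg; apply/cauchy_exP => e e0.
  have [n ne] := half_small _ e0.
  exists (u n t); exists n => // m /= nm; rewrite /ball/= distrC.
  rewrite -(subnKC nm); apply: le_lt_trans (dmn n (m - n)%N t t01) _.
  by apply: le_lt_trans ne; apply: (ler_wpM2l (An n)); exact: wW.
pose s t := limn (fun n => u n (clamp 0 1 t)).
have sE t : t \in `[0, 1] -> s t = limn (fun n => u n t).
  by move=> t01; rewrite /s clamp01_id.
have su n t : t \in `[0, 1] -> `|s t - u n t| <= 2 * A / 2 ^+ n * weight k t.
  move=> t01; rewrite sE//.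
  have : `|u m t - u n t| @[m --> \oo] --> `|limn (fun n => u n t) - u n t|.
    by apply: cvg_norm; apply: cvgB; [exact: cu|exact: cvg_cst].
  move=> h; rewrite -(cvg_lim _ h)//; apply: limr_le; first by apply/cvg_ex; eexists; exact: h.
  by near=> m; rewrite -(@subnKC n m); [exact: dmn|near: m; exists n].
have sc : continuous s.
  have sclamp t : s t = s (clamp 0 1 t) by rewrite /s (clamp01_id (clamp01P t)).
  move=> x; apply/cvgrPdist_lt => e e0.
  have e3 : 0 < e / 3 by rewrite divr_gt0.
  have [n ne] := half_small _ e3.
  have sun t : `|s t - u n (clamp 0 1 t)| < e / 3.
    rewrite sclamp; apply: le_lt_trans (su n _ (clamp01P t)) _.
    by apply: le_lt_trans ne; apply: (ler_wpM2l (An n)); apply: wW; exact: clamp01P.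
  have : u n (clamp 0 1 y) @[y --> x] --> u n (clamp 0 1 x).
    exact: (continuous_comp (@clamp_continuous R 0 1 x) (uc n _)).
  move/cvgrPdist_lt => /(_ _ e3); apply: filterS => y hy.
  have hx := sun x; have hyy := sun y; rewrite distrC in hyy.
  have -> : s x - s y = (s x - u n (clamp 0 1 x)) + (u n (clamp 0 1 x) - u n (clamp 0 1 y)) + (u n (clamp 0 1 y) - s y) by ring.
  apply: le_lt_trans (ler_normD _ _) _.
  have := ler_normD (s x - u n (clamp 0 1 x)) (u n (clamp 0 1 x) - u n (clamp 0 1 y)).
  lra.
exists s; split => // t t01; apply/eqP; rewrite -subr_eq0 -normr_le0.
apply/ler_addgt0Pl => e e0; rewrite addr0.
have [n ne] := half_small _ (divr_gt0 e0 (ltr0Sn R 1)).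
have h1 := su n.+1 t t01.
have h2 := Tcontr _ _ _ sc (uc n) (An n) (su n) t t01.
rewrite -[u n.+1]/(T (u n)) distrC in h1.
have -> : s t - T s t = - ((T (u n) t - s t) + (T s t - T (u n) t)) by ring.
rewrite normrN; apply: le_trans (ler_normD _ _) _.
have := lerD h1 h2; move/le_trans; apply.
have -> : 2 * A / 2 ^+ n.+1 = 2 * A / 2 ^+ n / 2 by rewrite exprSr invfM mulrA.
have : 2 * A / 2 ^+ n * weight k t <= 2 * A / 2 ^+ n * W by apply: (ler_wpM2l (An n)); exact: wW.
lra.
Unshelve. all: by end_near. Qed.

End picard.

(** * Shooting for the truncated Euler system *)
Section shooting.
Context {R : realType}.
Variables (G phi : R -> R) (l M lam : R).
Implicit Types (s sa sb : R -> R) (a b t : R).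
Hypotheses (l0 : 0 < l) (lam0 : 0 < lam) (M0 : 0 <= M).
Hypothesis Glip : forall x y, `|G x - G y| <= l * `|x - y|.
Hypothesis Gbd : forall x, `|G x| <= M.
Hypothesis phic : continuous phi.
Hypothesis phi01 : forall t : R, t \in `[0, 1] -> 0 <= phi t <= 1.

Lemma lipschitz_continuous (g : R -> R) (C : R) :
  (forall x y, `|g x - g y| <= C * `|x - y|) -> continuous g.
Proof.
move=> gC x; apply/cvgrPdist_lt => e e0.
have C1 : 0 < `|C| + 1 by rewrite ltr_wpDl.
near=> y; apply: le_lt_trans (gC _ _) _.
apply: (@le_lt_trans _ _ ((`|C| + 1) * `|x - y|)).
  by rewrite ler_wpM2r//; apply: le_trans (ler_norm C) _; rewrite lerDl.
rewrite mulrC -ltr_pdivlMr//; near: y.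
by apply: cvgr_dist_lt => //; rewrite divr_gt0.
Unshelve. all: by end_near. Qed.

Lemma prim_bounds (g : R -> R) (lo hi : R) : continuous g ->
  (forall t, t \in `[0, 1] -> lo <= g t <= hi) ->
  forall t, t \in `[0, 1] -> lo * t <= prim g t <= hi * t.
Proof.
move=> cg gb t; rewrite in_itv/= => /andP[t0 t1].
have d := @is_derive_mull R.
have g01 x : x \in `[0, t] -> lo <= g x <= hi.
  by rewrite in_itv/= => /andP[x0 xt]; apply: gb; rewrite in_itv/= x0 (le_trans xt).
have h1 : prim g t - prim g 0 <= hi * t - hi * 0.
  by apply: (le_prim_increment cg (d hi)) => // x /g01 /andP[].
have h2 : lo * t - lo * 0 <= prim g t - prim g 0.
  by apply: (ge_prim_increment cg (d lo)) => // x /g01 /andP[].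
by move: h1 h2; rewrite prim0 !mulr0 !subr0 => -> ->.
Qed.

Let Gc : continuous G. Proof. exact: lipschitz_continuous Glip. Qed.

Let Gsc (s : R -> R) : continuous s -> continuous (G \o s).
Proof. by move=> sc x; exact: (@continuous_comp _ _ _ s G x (sc x) (@Gc (s x))). Qed.

(** The system is reduced to the single unknown [s], as [v] is recovered from [s]
and the initial value; it then reads [s = prim (shoot_rhs a s)]. *)
Definition shoot_v (a : R) (s : R -> R) (t : R) : R := a + prim (G \o s) t.

Definition shoot_rhs (a : R) (s : R -> R) (t : R) : R := lam * (shoot_v a s t - phi t).

Lemma shoot_v_continuous a s : continuous s -> continuous (shoot_v a s).
Proof.
move=> sc x; apply: cvgD; first exact: cvg_cst.
exact: (@prim_continuous _ (G \o s) (Gsc sc)).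
Qed.

Lemma shoot_rhs_continuous a s : continuous s -> continuous (shoot_rhs a s).
Proof.
move=> sc x; apply: cvgM; first exact: cvg_cst.
by apply: cvgB; [exact: shoot_v_continuous|exact: phic].
Qed.

(* two integrations gain k^-2, and lam * l / k^2 <= 1/2 for this k *)
Let k : R := 1 + 2 * lam * l.
Let k0 : 0 < k. Proof. by rewrite /k ltr_pwDl// ltW// !mulr_gt0. Qed.

Lemma shoot_contraction a s1 s2 (A : R) : continuous s1 -> continuous s2 -> 0 <= A ->
  (forall t, t \in `[0, 1] -> `|s1 t - s2 t| <= A * weight k t) ->
  forall t, t \in `[0, 1] ->
    `|prim (shoot_rhs a s1) t - prim (shoot_rhs a s2) t| <= A / 2 * weight k t.
Proof.
move=> c1 c2 A0 s12 t t01.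
have cG := Gsc.
have cB g1 g2 : continuous g1 -> continuous g2 -> continuous (g1 \- g2 : R -> R).
  by move=> h1 h2 x; apply: cvgB; [exact: h1|exact: h2].
have lA0 : 0 <= l * A by rewrite mulr_ge0// ltW.
have h1 x : x \in `[0, 1] -> `|prim ((G \o s1) \- (G \o s2)) x| <= l * A / k * weight k x.
  have cD := cB _ _ (cG _ c1) (cG _ c2).
  apply: (prim_weight_le k0 lA0 cD) => // y y01.
  by apply: le_trans (Glip _ _) _; rewrite -mulrA ler_pM2l// s12.
have B0 : 0 <= lam * (l * A / k) by rewrite mulr_ge0 ?divr_ge0// ltW.
rewrite primB; [|exact: shoot_rhs_continuous..].
apply: (@le_trans _ _ (lam * (l * A / k) / k * weight k t)).
  have cD := cB _ _ (@shoot_rhs_continuous a _ c1) (@shoot_rhs_continuous a _ c2).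
  apply: (prim_weight_le k0 B0 cD) => // y y01.
  have -> : (shoot_rhs a s1 \- shoot_rhs a s2) y = lam * (prim ((G \o s1) \- (G \o s2)) y).
    rewrite /= -primB; [|exact: cG..].
    by rewrite /shoot_rhs /shoot_v; ring.
  by rewrite normrM gtr0_norm// -(mulrA lam) ler_pM2l// h1.
apply: ler_wpM2r; first exact/ltW/weight_gt0.
have -> : lam * (l * A / k) / k = A * ((lam * l) / (k * k)) by field; rewrite gt_eqF.
apply: ler_wpM2l => //; rewrite ler_pdivrMr ?mulr_gt0//.
have := mulr_gt0 lam0 l0; rewrite /k; set z := lam * l => z0.
have -> : 2 * lam * l = 2 * z by rewrite /z; ring.
nra.
Qed.

Lemma shoot_exists a : exists s, continuous s /\
  forall t, t \in `[0, 1] -> s t = prim (shoot_rhs a s) t.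
Proof.
apply: (@weighted_fixpoint R (fun s => prim (shoot_rhs a s)) k (ltW k0)).
  by move=> s sc; apply: prim_continuous; exact: shoot_rhs_continuous.
exact: shoot_contraction.
Qed.

(** Continuous dependence on the initial value: the contraction absorbs half of
the weighted distance [D] of the two solutions, and the rest is due to the
difference of the right-hand sides. *)
Lemma shoot_stable a b sa sb : continuous sa -> continuous sb ->
  (forall t, t \in `[0, 1] -> sa t = prim (shoot_rhs a sa) t) ->
  (forall t, t \in `[0, 1] -> sb t = prim (shoot_rhs b sb) t) ->
  forall t, t \in `[0, 1] -> `|sa t - sb t| <= 2 * lam * weight k 1 * `|a - b|.
Proof.
move=> ca cb ea eb t t01.
have wc : continuous (fun t => `|sa t - sb t| * (weight k t)^-1).
  move=> x; apply: cvgM; first exact: cvg_norm (cvgB (ca x) (cb x)).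
  by apply: cvgV; [rewrite gt_eqF// weight_gt0|exact: weight_continuous].
have [c c01 cmax] := @EVT_max R _ 0 1 ler01 (continuous_subspaceT wc).
pose D : R := `|sa c - sb c| * (weight k c)^-1.
have D0 : 0 <= D by rewrite mulr_ge0// invr_ge0 ltW// weight_gt0.
have hD x : x \in `[0, 1] -> `|sa x - sb x| <= D * weight k x.
  by move=> /cmax/=; rewrite -/D ler_pdivrMr// weight_gt0.
have hc := shoot_contraction a ca cb D0 hD c01.
have hab : `|prim (shoot_rhs a sb) c - prim (shoot_rhs b sb) c| <= lam * `|a - b|.
  rewrite primB; [|exact: shoot_rhs_continuous..].
  have cab : continuous (shoot_rhs a sb \- shoot_rhs b sb).
    by move=> x; apply: cvgB; exact: shoot_rhs_continuous.
  have hE x : (shoot_rhs a sb \- shoot_rhs b sb) x = lam * (a - b).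
    by rewrite /shoot_rhs /shoot_v /=; ring.
  have hn : 0 <= lam * `|a - b| by rewrite mulr_ge0// ltW.
  have hb x : x \in `[0, 1] -> - (lam * `|a - b|) <= (shoot_rhs a sb \- shoot_rhs b sb) x <= lam * `|a - b|.
    by move=> _; rewrite hE -ler_norml normrM gtr0_norm.
  have := prim_bounds cab hb c01.
  move: c01; rewrite in_itv/= => /andP[c0 c1] /andP[u1 u2].
  rewrite ler_norml; apply/andP; split.
    by apply: le_trans u1; rewrite mulNr lerN2 ler_piMr.
  by apply: le_trans u2 _; rewrite ler_piMr.
have w1 : 1 <= weight k c.
  by apply: weight_ge1; [exact: ltW|move: c01; rewrite in_itv/= => /andP[]].
have DE : D * weight k c = `|sa c - sb c| by rewrite /D divfK// gt_eqF// weight_gt0.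
have hDc : D * weight k c <= (D / 2 + lam * `|a - b|) * weight k c.
  rewrite DE ea// eb// -(subrKA (prim (shoot_rhs a sb) c)).
  apply: le_trans (ler_normD _ _) _; rewrite mulrDl lerD//.
  by apply: le_trans hab _; rewrite ler_peMr// mulr_ge0// ltW.
have D2 : D <= 2 * lam * `|a - b|.
  by move: hDc; rewrite ler_pM2r ?weight_gt0// => h; lra.
apply: le_trans (hD t t01) _.
have -> : 2 * lam * weight k 1 * `|a - b| = 2 * lam * `|a - b| * weight k 1 by ring.
apply: ler_pM => //; first by rewrite ltW// weight_gt0.
move: t01; rewrite in_itv/= => /andP[_ t1].
by rewrite ler_expR ler_wpM2l// ltW.
Qed.

(** Since [v] stays within [M] of its initial value, [v <= 0 <= phi] for [a = - M]
and [v >= 1 >= phi] for [a = 1 + M], which fixes the sign of [s 1]. *)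
Lemma shooting : exists a s, [/\ continuous s,
  (forall t, t \in `[0, 1] -> s t = prim (shoot_rhs a s) t) & s 1 = 0].
Proof.
have [S SP] := choice shoot_exists.
have Sc a : continuous (S a) by case: (SP a).
have Se a t : t \in `[0, 1] -> S a t = prim (shoot_rhs a (S a)) t.
  by case: (SP a) => _; exact.
have one01 : (1 : R) \in `[0, 1] by rewrite in_itv/= lexx ler01.
pose h a := S a 1.
have hc : continuous h.
  apply: (@lipschitz_continuous _ (2 * lam * weight k 1)) => a b.
  exact: (shoot_stable (Sc a) (Sc b) (Se a) (Se b) one01).
have hv a t : t \in `[0, 1] -> a - M <= shoot_v a (S a) t <= a + M.
  move=> t01.
  have cG : continuous (G \o S a) := Gsc (Sc a).
  have hb x : x \in `[0, 1] -> - M <= (G \o S a) x <= M by move=> _; rewrite -ler_norml; exact: Gbd.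
  have := prim_bounds cG hb t01.
  move: t01; rewrite in_itv/= => /andP[t0 t1] /andP[h1 h2].
  have Mt : M * t <= M by rewrite ler_piMr.
  by rewrite /shoot_v; apply/andP; split; lra.
have cr a : continuous (shoot_rhs a (S a)) by exact: shoot_rhs_continuous.
have h0 : h (- M) <= 0.
  rewrite /h Se//.
  have d (x : R) : is_derive x 1 (cst 0 : R -> R) ((cst 0 : R -> R) x) by exact: is_derive_cst.
  have := le_prim_increment (cr (- M)) d (lexx 0) ler01 (lexx 1).
  rewrite prim0 /= !subr0; apply => x x01.
  have /andP[_ ?] := hv (- M) x x01; have /andP[? _] := phi01 x01.
  by rewrite /shoot_rhs pmulr_rle0//; lra.
have h1 : 0 <= h (1 + M).
  rewrite /h Se//.
  have d (x : R) : is_derive x 1 (cst 0 : R -> R) ((cst 0 : R -> R) x) by exact: is_derive_cst.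
  have := ge_prim_increment (cr (1 + M)) d (lexx 0) ler01 (lexx 1).
  rewrite prim0 /= !subr0; apply => x x01.
  have /andP[? _] := hv (1 + M) x x01; have /andP[_ ?] := phi01 x01.
  by rewrite /shoot_rhs pmulr_rge0//; lra.
have hM : - M <= 1 + M by have := M0; lra.
have h01 : Num.min (h (- M)) (h (1 + M)) <= 0 <= Num.max (h (- M)) (h (1 + M)).
  by rewrite ge_min h0 le_max h1 orbT.
have [a _ ha] := IVT hM (continuous_subspaceT hc) h01.
by exists a, (S a); split => //; exact: Se.
Qed.

End shooting.

(** * The maximum principle and inversion of the dual variable *)
Section euler.
Context {R : realType}.
Implicit Types (F f p v phi S dv dS P : R -> R) (a b x y t : R).

(** At a maximum point [c] of [S] with [B <= S c] one has [v c = phi c]. Close to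
[c] the slope of [v] exceeds that of [phi], so [v > phi] and [S] increases to the
right of [c], which is absurd. *)
Lemma max_principle v phi S dv dS (L M B lam : R) :
  0 < lam -> L < M -> 0 < B ->
  (forall x, is_derive x 1 v (dv x)) -> (forall x, is_derive x 1 S (dS x)) ->
  (forall x, x \in `[0, 1] -> dS x = lam * (v x - phi x)) ->
  S 0 = 0 -> S 1 = 0 -> continuous dv ->
  (forall t, t \in `[0, 1] -> B <= S t -> M <= dv t) ->
  (forall x y, x \in `[0, 1] -> y \in `[0, 1] -> x <= y ->
     phi y - phi x <= L * (y - x)) ->
  forall t, t \in `[0, 1] -> S t < B.
Proof.
move=> lam0 LM B0 vd Sd dSE S0 S1 dvc BM phiL.
have [c c01 cmax] := EVT_max ler01 (continuous_subspaceT (is_derive_continuous Sd)).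
suff cB : S c < B by move=> t /cmax /le_lt_trans; exact.
rewrite ltNge; apply/negP => Bc.
have c01' : 0 < c < 1.
  move: c01; rewrite in_itv/= => /andP[c0 c1].
  rewrite !lt_neqAle c0 c1 !andbT; apply/andP; split; apply/eqP => ce.
    by move: Bc; rewrite -ce S0; lra.
  by move: Bc; rewrite ce S1; lra.
have /andP[c0 c1] := c01'.
have dSc : dS c = 0.
  have h : is_derive c 1 S 0.
    apply: (@derive1_at_max _ S 0 1 c ler01) => //.
    by move=> t; rewrite in_itv/= => /andP[t0 t1]; apply: cmax; rewrite in_itv/= !ltW.
  have := Sd c; case: h => _ h1; case => _; rewrite -h1 => ->//.
have vphi : v c = phi c.
  by move: dSc; rewrite dSE// => /eqP; rewrite mulf_eq0 gt_eqF//= subr_eq0 => /eqP.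
(* a slope strictly between L and M survives in a neighbourhood of c *)
pose K := (L + M) / 2.
have KM : K < M by rewrite /K; lra.
have LK : L < K by rewrite /K; lra.
have [d d0 dK] : exists2 d : R, 0 < d & forall x, `|c - x| < d -> K < dv x.
  have : \forall x \near c, K < dv x.
    exact: (cvgr_gt _ (dvc c) _ (lt_le_trans KM (BM _ c01 Bc))).
  by move=> /nbhs_ballP[d /= d0 dK]; exists d => // x; exact: dK.
pose e := Num.min (d / 2) (1 - c).
have e0 : 0 < e by rewrite /e lt_min; apply/andP; split; lra.
have ed : e <= d / 2 by rewrite /e ge_min lexx.
have e1 : c + e <= 1 by rewrite -lerBrDl /e ge_min lexx orbT.
have in01 x : x \in `[c, c + e] -> x \in `[0, 1].
  by rewrite !in_itv/= => /andP[? ?]; apply/andP; split; lra.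
have vK x : x \in `[c, c + e] -> K * (x - c) <= v x - v c.
  move=> xc; have := xc; rewrite in_itv/= => /andP[cx xe].
  rewrite mulrBr; apply: (le_increment (is_derive_mull K) vd cx) => y.
  rewrite in_itv/= => /andP[cy yx]; apply/ltW/dK.
  by rewrite distrC ger0_norm; lra.
have dSK x : x \in `[c, c + e] -> lam * (K - L) * (x - c) <= dS x.
  move=> xc; have := xc; rewrite in_itv/= => /andP[cx xe].
  rewrite dSE ?in01// -mulrA ler_pM2l//.
  have := vK x xc; have := phiL c x c01 (in01 _ xc) cx; rewrite mulrBl; lra.
pose q x := lam * (K - L) / 2 * ((x - c) * (x - c)).
have qd x : is_derive x 1 q (lam * (K - L) * (x - c)).
  have d1 : is_derive x 1 (fun y : R => y - c) (1 - 0).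
    by exact: (@is_deriveB _ _ _ id (cst c)).
  have h := @is_deriveZ _ _ _ _ (lam * (K - L) / 2) _ _ _ (is_deriveM d1 d1).
  by apply: (is_derive_eq h); rewrite /GRing.scale/=; field.
have := le_increment qd Sd (_ : c <= c + e) dSK.
rewrite lerDl ltW// => /(_ isT).
have -> : q (c + e) - q c = lam * (K - L) / 2 * (e * e) by rewrite /q; ring.
have : 0 < lam * (K - L) / 2 * (e * e) by rewrite !mulr_gt0 ?subr_gt0.
have : c + e \in `[0, 1] by rewrite in_itv/= e1 addr_ge0// ltW.
by move/cmax; lra.
Qed.

(** [G] inverts [P] on [[- M, M]] and is constant outside of its image. It is
Lipschitz because [dP] is bounded below on that compact interval. *)
Lemma truncated_inverse P dP (M : R) : 0 < M ->
  (forall x, is_derive x 1 P (dP x)) -> continuous dP -> (forall x, 0 < dP x) ->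
  exists G (l : R), [/\ 0 < l, forall x y, `|G x - G y| <= l * `|x - y|,
    forall x, `|G x| <= M, forall x, P (- M) <= x <= P M -> P (G x) = x &
    (forall x, P M <= x -> G x = M) /\ (forall x, x <= P (- M) -> G x = - M)].
Proof.
move=> M0 Pd dPc dP0.
have MM : - M <= M by lra.
have [c c01 cmin] := EVT_min MM (continuous_subspaceT dPc).
have growth x y : x \in `[- M, M] -> y \in `[- M, M] -> x <= y ->
    dP c * (y - x) <= P y - P x.
  rewrite !in_itv/= => /andP[x1 x2] /andP[y1 y2] xy.
  rewrite mulrBr; apply: (le_increment (is_derive_mull (dP c)) Pd xy) => z.
  by rewrite in_itv/= => /andP[z1 z2]; apply: cmin; rewrite in_itv/=; apply/andP; split; lra.
have Minm : (- M) \in `[- M, M] by rewrite in_itv/= lexx.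
have MinM : M \in `[- M, M] by rewrite in_itv/= lexx andbT.
have PM : P (- M) <= P M.
  by rewrite -subr_ge0; apply: le_trans (growth _ _ Minm MinM MM); rewrite mulr_ge0// ?subr_ge0// ltW.
pose cl := clamp (P (- M)) (P M).
have clP x : P (- M) <= cl x <= P M by exact: clamp_itv.
have exG x : exists y : R, y \in `[- M, M] /\ P y = cl x.
  have hv : Num.min (P (- M)) (P M) <= cl x <= Num.max (P (- M)) (P M).
    by rewrite min_l// max_r.
  have [y yM Py] := IVT MM (continuous_subspaceT (is_derive_continuous Pd)) hv.
  by exists y.
have [G GP] := choice exG.
have Pinj x y : x \in `[- M, M] -> y \in `[- M, M] -> dP c * `|x - y| <= `|P x - P y|.
  move=> xM yM; wlog xy : x y xM yM / x <= y.
    by move=> h; case: (leP x y) => [|/ltW] ? ; [exact: h|rewrite distrC (distrC (P x)); exact: h].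
  rewrite distrC (distrC (P x)) ger0_norm ?subr_ge0//.
  by apply: le_trans (growth _ _ xM yM xy) (ler_norm _).
have GE x y : y \in `[- M, M] -> cl x = P y -> G x = y.
  move=> yM xy; have [GM PG] := GP x.
  have := Pinj _ _ GM yM; rewrite PG xy subrr normr0 pmulr_rle0// normr_le0 subr_eq0.
  by move/eqP.
exists G, (dP c)^-1; split.
- by rewrite invr_gt0.
- move=> x y; have [GM PG] := GP x; have [GM' PG'] := GP y.
  rewrite ler_pdivlMl//; apply: le_trans (Pinj _ _ GM GM') _; rewrite PG PG'.
  exact: clamp_lipschitz.
- by move=> x; have [+ _] := GP x; rewrite in_itv/= ler_norml.
- by move=> x /andP[x1 x2]; have [_ ->] := GP x; rewrite /cl clamp_id// x1.
- split=> x xM; apply: GE => //; rewrite /cl /clamp; first by rewrite min_l// max_r.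
  by rewrite max_l// ge_min xM orbT.
Qed.

(** If [P (p x) = S x] with [P] and [S] differentiable and [P' > 0] then [p] is
differentiable with [p' = S' / P' (p)]: the difference quotient of [p] is the
quotient of the Caratheodory slopes of [S] and [P]. *)
Lemma C2_on_01_of_implicit v p S dv dS P dP h :
  (forall x, is_derive x 1 v (dv x)) -> (forall x, x \in `[0, 1] -> dv x = p x) ->
  (forall x, is_derive x 1 S (dS x)) -> (forall x, x \in `[0, 1] -> dS x = h x) ->
  (forall x, is_derive x 1 P (dP x)) -> (forall x, 0 < dP x) ->
  continuous dP -> continuous p -> continuous h ->
  (forall x, x \in `[0, 1] -> P (p x) = S x) -> C2_on_01 v.
Proof.
move=> vd vp Sd Sh Pd dP0 dPc pc hc PS.
exists p, (fun x => h x / dP (p x)); split.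
- move=> x x01; rewrite -vp//.
  have /is_derive1_caratheodory [g [gE gc gx]] := vd x.
  rewrite -gx; apply: cvg_within_filter.
  have : g y @[y --> x^'] --> g x by apply: cvg_within_filter.
  apply: cvg_trans; apply: near_eq_cvg.
  near=> y; rewrite gE mulfK// subr_eq0; near: y; exact: nbhs_dnbhs_neq.
- move=> x x01.
  have /is_derive1_caratheodory [g [gE gc gx]] := Sd x.
  have /is_derive1_caratheodory [k [kE kc kx]] := Pd (p x).
  rewrite -Sh// -gx -kx.
  have kpc : k (p y) @[y --> x] --> k (p x).
    exact: (continuous_comp (pc x) kc).
  have k0 : k (p x) != 0 by rewrite kx gt_eqF.
  have : g y / k (p y) @[y --> within `[0, 1]%classic x^'] --> g x / k (p x).
    apply: cvg_within_filter; apply: cvg_within_filter.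
    by apply: cvgM; [exact: gc|exact: cvgV].
  apply: cvg_trans; apply: near_eq_cvg.
  near=> y.
  have y01 : y \in `[0, 1] by near: y; exact: withinT.
  have yx : y - x != 0.
    by rewrite subr_eq0; near: y; apply: cvg_within; exact: withinT.
  have ky : k (p y) != 0.
    near: y; apply: cvg_within; apply: cvg_within.
    exact: (cvgr_neq0 _ kpc).
  have := gE y; rewrite -!PS// kE => e.
  by apply/eqP; rewrite eq_sym eqr_div// -e mulrC.
- apply: continuous_subspaceT => x; apply: cvgM; first exact: hc.
  apply: cvgV; first by rewrite gt_eqF.
  exact: (continuous_comp (pc x) (dPc _)).
Unshelve. all: by end_near. Qed.

End euler.

(** * The smooth solution of the Neumann problem *)
Section bvp.
Context {R : realType}.
Implicit Types (F f p phi : R -> R) (a b x y t : R).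

Lemma lipschitz01P f : [lipschitz f t | t in `[0, 1]%classic] ->
  exists2 L : R, 0 < L & forall x y, x \in `[0, 1] -> y \in `[0, 1] ->
    `|f x - f y| <= L * `|x - y|.
Proof.
move=> [M [_ HM]]; exists (Num.max M 0 + 1).
  by rewrite ltr_pwDr// le_max lexx orbT.
move=> x y x01 y01.
have ML : M < Num.max M 0 + 1 by rewrite ltr_pwDr// le_max lexx.
exact: (HM _ ML (x, y) (conj x01 y01)).
Qed.

Lemma condF1_derive F : condF1 F ->
  (forall x, is_derive x 1 F (F^`()%classic x)) /\
  (forall x, is_derive x 1 (F^`()%classic) (F^`(2)%classic x)).
Proof.
move=> [[F1 F2] _ _ _]; split=> x.
  by apply: DeriveDef; [exact: F1|rewrite -derive1E].
by apply: DeriveDef; [exact: F2|rewrite -derive1E derive1nS derive1n1].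
Qed.

Lemma condF1_odd F x : condF1 F -> F^`()%classic (- x) = - F^`()%classic x.
Proof.
move=> F1; have [Fd _] := condF1_derive F1; case: F1 => _ _ Feven _.
have h1 : is_derive x 1 (F \o -%R) (F^`()%classic (- x) * -1).
  exact: is_derive1_comp.
have FE : F \o -%R = F by apply/funext => y /=.
rewrite FE in h1.
have h2 := Fd x.
have e1 := @derive_val _ _ _ _ _ _ _ h1; have e2 := @derive_val _ _ _ _ _ _ _ h2.
by rewrite -e2 e1 mulrN1 opprK.
Qed.

(** [phi] extends [f] from [0,1] to the line, and [prim h] is the dual variable
[F'(v')]. *)
Lemma euler_bvp F f (lam : R) : condF1 F -> condF4 F -> 0 < lam ->
  (forall t, t \in `[0, 1] -> 0 <= f t <= 1) ->
  [lipschitz f t | t in `[0, 1]%classic] ->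
  exists a p phi, [/\ continuous phi, continuous p,
    forall t, t \in `[0, 1] -> phi t = f t &
    let v t := a + prim p t in let h t := lam * (v t - phi t) in
    [/\ prim h 1 = 0, forall t, t \in `[0, 1] -> F^`()%classic (p t) = prim h t
      & C2_on_01 v]].
Proof.
move=> F1 F4 lam0 f01 /lipschitz01P[L L0 fL].
have [Fd F'd] := condF1_derive F1.
have F2c : continuous (F^`(2)%classic) by case: F1.
pose P : R -> R := F^`()%classic.
have P0 : P 0 = 0 by have := condF1_odd 0 F1; rewrite oppr0 -/P; lra.
pose phi t := f (clamp 0 1 t).
have phiE t : t \in `[0, 1] -> phi t = f t by move=> t01; rewrite /phi clamp01_id.
have phiL x y : `|phi x - phi y| <= L * `|x - y|.
  apply: le_trans (fL _ _ (clamp01P x) (clamp01P y)) _.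
  by rewrite ler_pM2l// clamp_lipschitz.
have phic : continuous phi := lipschitz_continuous phiL.
have phi01 t : t \in `[0, 1] -> 0 <= phi t <= 1 by move=> t01; rewrite phiE// f01.
pose M := L + 1.
have M0 : 0 < M by rewrite addr_gt0.
have LM : L < M by rewrite ltrDl.
have [G [l [l0 Gl GM PG [Ghi Glo]]]] := truncated_inverse M0 F'd F2c F4.
have [a [s [sc sE s1]]] := shooting l0 lam0 (ltW M0) Gl GM phic phi01.
pose p := G \o s.
have Gc : continuous G := lipschitz_continuous Gl.
have pc : continuous p by move=> x; exact: (continuous_comp (sc x) (@Gc _)).
pose v t := a + prim p t; pose h t := lam * (v t - phi t).
have sh t : t \in `[0, 1] -> s t = prim h t by exact: sE.
have one01 : (1 : R) \in `[0, 1] by rewrite in_itv/= ler01 lexx.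
have h1 : prim h 1 = 0 by rewrite -sh.
have hc : continuous h by exact: (shoot_rhs_continuous Gl phic).
have vd : forall x, is_derive x 1 v (plateau x * p x) := is_derive_add_prim a pc.
have vp t : t \in `[0, 1] -> plateau t * p t = p t.
  by move=> t01; rewrite plateau1// mul1r.
have Shd := is_derive_prim hc.
have Sh t : t \in `[0, 1] -> plateau t * h t = h t.
  by move=> t01; rewrite plateau1// mul1r.
have dvc : continuous (fun t => plateau t * p t).
  by move=> t; apply: cvgM; [exact: plateau_continuous|exact: pc].
have Pmono x y : x < y -> P x < P y.
  move=> xy.
  have [c cxy] := MVT xy (fun z _ => F'd z) (continuous_subspaceT (is_derive_continuous F'd)).
  by rewrite -/P => E; rewrite -subr_gt0 E mulr_gt0// subr_gt0.
have PM0 : 0 < P M by rewrite -P0; exact: Pmono.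
have PNM : P (- M) = - P M by exact: condF1_odd.
(* the dual variable stays below F'(M), so the truncation is inactive *)
have up t : t \in `[0, 1] -> prim h t < P M.
  apply: (max_principle (phi := phi) lam0 LM PM0 vd Shd) => //.
  - exact: prim0.
  - by move=> x x01; rewrite -sh// vp// /p /= => /Ghi ->.
  - move=> x y _ _ xy; apply: le_trans (ler_norm _) _.
    by apply: le_trans (phiL _ _) _; rewrite ger0_norm// subr_ge0.
(* the lower bound is the upper one for the reflected problem *)
have lo t : t \in `[0, 1] -> - P M < prim h t.
  move=> t01; rewrite ltrNl.
  apply: (max_principle (phi := \- phi) (S := \- prim h) (v := \- v)
    (dv := fun t => - (plateau t * p t)) (dS := fun t => - (plateau t * h t)) lam0 LM PM0) => //.
  - by move=> x x01; rewrite Sh// /h /=; ring.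
  - by rewrite /= prim0 oppr0.
  - by rewrite /= h1 oppr0.
  - by move=> x; apply: cvgN; exact: dvc.
  - move=> x x01 /=; rewrite -sh// vp// /p /= lerNr -PNM => /Glo ->.
    by rewrite opprK.
  - move=> x y _ _ xy; apply: le_trans (ler_norm _) _ => /=.
    by rewrite opprK addrC; apply: le_trans (phiL _ _) _; rewrite distrC ger0_norm// subr_ge0.
have Pp t : t \in `[0, 1] -> P (p t) = prim h t.
  move=> t01; rewrite -sh//; apply: PG.
  by rewrite -/P PNM sh// (ltW (lo _ t01)) (ltW (up _ t01)).
exists a, p, phi; split => //; split => //.
exact: (C2_on_01_of_implicit vd vp Shd Sh F'd F4 F2c pc hc Pp).
Qed.

End bvp.

(** * Cutoff functions *)
Section cutoff.
Context {R : realType}.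
Implicit Types (a b x y t : R).

(** The square of the positive part, written so that its difference quotient at
0 is visibly [Num.max 0 y]. *)
Definition sqpos y : R := Num.max 0 y * y.

Lemma sqpos_ge0 y : 0 <= sqpos y.
Proof. by rewrite /sqpos; case: (leP 0 y) => [y0|_]; rewrite ?mul0r// mulr_ge0. Qed.

Lemma pos_continuous : continuous (fun y : R => Num.max 0 y).
Proof. by move=> x; exact: (continuous_max (cvg_cst _) (@cvg_id _ _)). Qed.

Lemma is_derive_sqpos y : is_derive y 1 sqpos (2 * Num.max 0 y).
Proof.
have [y0|y0|->] := ltrgtP y 0.
- rewrite mulr0; apply: (@near_eq_is_derive _ _ _ (cst 0)).
  near=> z; rewrite /sqpos max_l ?mul0r// ltW//.
  by near: z; exact: lt_nbhsl.
- apply: (@near_eq_is_derive _ _ _ (id * id : R -> R)).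
    near=> z; rewrite /sqpos max_r// ltW//; near: z; exact: lt_nbhsr.
  apply: (is_derive_eq (is_deriveM (is_derive_id y 1) (is_derive_id y 1))).
  by rewrite /GRing.scale/=; ring.
- rewrite mulr0; apply/is_derive1_caratheodory; exists (fun z => Num.max 0 z).
  split=> [z||]; last by rewrite maxxx.
    by rewrite /sqpos mulr0 !subr0.
  exact: pos_continuous.
Unshelve. all: by end_near. Qed.

(** A C1 function that vanishes for [y <= 1] and tends to 1 at infinity. *)
Definition step y : R := 1 - (1 + sqpos (y - 1))^-1.
Definition dstep y : R := 2 * Num.max 0 (y - 1) / (1 + sqpos (y - 1)) ^+ 2.

Lemma is_derive_step y : is_derive y 1 step (dstep y).
Proof.
have d1 : is_derive y 1 (fun y : R => y - 1) (1 - 0).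
  exact: (@is_deriveB _ _ _ id (cst (1:R))).
have d2 : is_derive y 1 (fun y : R => sqpos (y - 1)) (2 * Num.max 0 (y - 1) * (1 - 0)).
  exact: (@is_derive1_comp _ sqpos (fun y => y - 1) y _ _ (is_derive_sqpos _) d1).
have d3 : is_derive y 1 (fun y : R => 1 + sqpos (y - 1)) (0 + 2 * Num.max 0 (y - 1) * (1 - 0)).
  exact: (@is_deriveD _ _ _ (cst (1:R)) (fun y : R => sqpos (y - 1))).
have n0 : 1 + sqpos (y - 1) != 0 by rewrite gt_eqF// ltr_pwDl// sqpos_ge0.
have d4 := @is_deriveV _ (fun y : R => 1 + sqpos (y - 1)) y _ _ n0 d3.
have d5 := @is_deriveB _ _ _ (cst (1:R)) _ _ _ _ _ (is_derive_cst (1:R) y 1) d4.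
by apply: (is_derive_eq d5); rewrite /dstep /GRing.scale/= ; field.
Qed.

Lemma sqpos_continuous : continuous sqpos.
Proof. exact: is_derive_continuous is_derive_sqpos. Qed.

Lemma dstep_continuous : continuous dstep.
Proof.
have c1 : continuous (fun y : R => y - 1) by move=> y; apply: cvgB; [exact: cvg_id|exact: cvg_cst].
move=> y; apply: cvgM.
  apply: cvgM; first exact: cvg_cst.
  exact: (continuous_comp (c1 y) (@pos_continuous _)).
apply: cvgV; first by rewrite expf_neq0// gt_eqF// ltr_pwDl// sqpos_ge0.
apply: (@cvg_comp _ _ _ (fun y => 1 + sqpos (y - 1)) (fun z => z ^+ 2)); last exact: exprn_continuous.
apply: cvgD; first exact: cvg_cst.
exact: (continuous_comp (c1 y) (@sqpos_continuous _)).
Qed.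

Lemma step_itv y : 0 <= step y <= 1.
Proof.
have h := sqpos_ge0 (y - 1); have h1 : 0 < 1 + sqpos (y - 1) by rewrite ltr_pwDl.
by rewrite /step subr_ge0 invf_le1// lerDl h/= gerBl invr_ge0 ltW.
Qed.

Lemma step_eq0 y : y <= 1 -> step y = 0.
Proof. by move=> y1; rewrite /step /sqpos max_l ?subr_le0// mul0r addr0 invr1 subrr. Qed.

Lemma dstep_eq0 y : y <= 1 -> dstep y = 0.
Proof. by move=> y1; rewrite /dstep max_l ?subr_le0// mulr0 mul0r. Qed.

Lemma dstep_ge0 y : 0 <= dstep y.
Proof. by rewrite divr_ge0 ?sqr_ge0// mulr_ge0// le_max lexx. Qed.

(** This scale invariant bound makes the derivatives of the cutoffs harmless: the
factor [n] produced by the chain rule is absorbed by the distance to the end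
points, and the product even tends to 0. *)
Lemma dstep_bound y : y * dstep y <= 4 * (1 - step y).
Proof.
rewrite /step subKr.
have [y1|y1] := leP y 1.
  by rewrite dstep_eq0// mulr0 mulr_ge0// invr_ge0 addr_ge0// sqpos_ge0.
have z0 : 0 < y - 1 by rewrite subr_gt0.
rewrite /dstep /sqpos (max_r (ltW z0)).
have -> : y * (2 * (y - 1) / (1 + (y - 1) * (y - 1)) ^+ 2) =
   (2 * y * (y - 1) / (1 + (y - 1) * (y - 1))) / (1 + (y - 1) * (y - 1)).
  by field; rewrite gt_eqF// ltr_pwDl// mulr_ge0// ltW.
have h : 0 < 1 + (y - 1) * (y - 1) by rewrite ltr_pwDl// mulr_ge0// ltW.
rewrite ler_pM2r ?invr_gt0// ler_pdivrMr//; nra.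
Qed.

Lemma step_cvg a : 0 < a -> step (n%:R * a) @[n --> \oo] --> (1 : R).
Proof.
move=> a0; apply/cvgrPdist_lt => e e0.
near=> n.
have h1 : 1 + e^-1 < n%:R * a.
  rewrite -ltr_pdivrMr//; near: n; exact: nbhs_infty_gtr.
have ei : 0 < e^-1 by rewrite invr_gt0.
have z0 : e^-1 < n%:R * a - 1 by lra.
rewrite /step subKr gtr0_norm; last by rewrite invr_gt0 ltr_pwDl// sqpos_ge0.
rewrite invf_plt ?posrE//; last by rewrite ltr_pwDl// sqpos_ge0.
rewrite /sqpos max_r; last by rewrite ltW// (lt_trans ei).
move: z0; set z := n%:R * a - 1 => z0.
have := sqr_ge0 (z - 1); rewrite expr2; lra.
Unshelve. all: by end_near. Qed.

(** Positive exactly on ]a, b[. *)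
Definition parab a b x : R := (x - a) * (b - x).

(** As [n] grows, [chi a b n] increases to the indicator of ]a, b[, and each
[chi a b n] vanishes near [a] and [b]. *)
Definition chi a b (n : nat) x : R := step (n%:R * parab a b x).
Definition dchi a b (n : nat) x : R := dstep (n%:R * parab a b x) * (n%:R * (a + b - 2 * x)).

Lemma is_derive_chi a b n x : is_derive x 1 (chi a b n) (dchi a b n x).
Proof.
have d1 : is_derive x 1 (fun x : R => x - a) (1 - 0).
  exact: (@is_deriveB _ _ _ id (cst a)).
have d2 : is_derive x 1 (fun x : R => b - x) (0 - 1).
  exact: (@is_deriveB _ _ _ (cst b) id).
have d3 := @is_deriveZ _ _ _ _ (n%:R) _ _ _ (is_deriveM d1 d2).
have d4 := @is_derive1_comp _ step _ x _ _ (is_derive_step _) d3.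
by apply: (is_derive_eq d4); rewrite /dchi /GRing.scale/= /parab; congr (_ * _); ring.
Qed.

Lemma parab_continuous a b : continuous (parab a b).
Proof.
move=> x; apply: cvgM; first by apply: cvgB; [exact: cvg_id|exact: cvg_cst].
by apply: cvgB; [exact: cvg_cst|exact: cvg_id].
Qed.

Lemma chi_continuous a b n : continuous (chi a b n).
Proof. exact: is_derive_continuous (is_derive_chi a b n). Qed.

Lemma dchi_continuous a b n : continuous (dchi a b n).
Proof.
have c1 : continuous (fun x => n%:R * parab a b x).
  by move=> x; apply: cvgM; [exact: cvg_cst|exact: parab_continuous].
move=> x; apply: cvgM; first exact: (continuous_comp (c1 x) (@dstep_continuous _)).
apply: cvgM; first exact: cvg_cst.
apply: cvgB; first exact: cvg_cst.
by apply: cvgM; [exact: cvg_cst|exact: cvg_id].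
Qed.

Lemma parab_gt0 a b x : a <= b -> (0 < parab a b x) = (x \in `]a, b[).
Proof.
move=> ab; rewrite in_itv/= /parab; apply/idP/idP => [h|/andP[xa xb]]; last first.
  by rewrite mulr_gt0 ?subr_gt0.
have [xa|xa] := leP x a; first by exfalso; nra.
by have [xb|//] := leP b x; exfalso; nra.
Qed.

Lemma chi_cvg a b x : x \in `]a, b[ -> chi a b n x @[n --> \oo] --> (1 : R).
Proof.
move=> xab; have ab : a <= b.
  by move: xab; rewrite in_itv/= => /andP[/ltW h1 /ltW]; exact: le_trans.
by apply: step_cvg; rewrite parab_gt0.
Qed.

Lemma chi_out a b n x : a <= b -> x \notin `]a, b[ -> chi a b n x = 0.
Proof.
move=> ab; rewrite -parab_gt0// -leNgt => h; apply: step_eq0.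
by apply: (@le_trans _ _ 0); rewrite // mulr_ge0_le0.
Qed.

(** The support is contained in the closed set where [n%:R * parab a b x] is at
least 1, which is a compact subset of ]a, b[. *)
Lemma C1_compact_support_chi a b n (s ds : R -> R) : 0 <= a -> a <= b -> b <= 1 ->
  (forall x, is_derive x 1 s (ds x)) -> continuous ds ->
  C1_compact_support (fun x => chi a b n x * s x) /\
  (fun x => chi a b n x * s x)^`()%classic = fun x => dchi a b n x * s x + chi a b n x * ds x.
Proof.
move=> a0 ab b1 sd dsc.
have d x : is_derive x 1 (fun x => chi a b n x * s x) (dchi a b n x * s x + chi a b n x * ds x).
  have h := is_deriveM (is_derive_chi a b n x) (sd x).
  by apply: (is_derive_eq h); rewrite /GRing.scale/=; ring.
have dE := is_derive_derive1 d.
split => //.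
pose N := [set x | 1 <= n%:R * parab a b x].
have Nc : closed N.
  have c1 : continuous (fun x => n%:R * parab a b x).
    by move=> x; apply: cvgM; [exact: cvg_cst|exact: parab_continuous].
  exact: (closed_comp (fun x _ => c1 x) (@closed_ge _ 1)).
have Nab : N `<=` `]a, b[%classic.
  move=> x; rewrite /N/= => h; have : 0 < parab a b x.
    rewrite ltNge; apply/negP => h'; have : n%:R * parab a b x <= 0 by rewrite mulr_ge0_le0.
    lra.
  by rewrite parab_gt0.
have SN : closure [set x | chi a b n x * s x != 0] `<=` N.
  rewrite [X in _ `<=` X]((closure_id N).1 Nc); apply: closure_subset => x /=.
  by apply: contraNT; rewrite /N/= -ltNge => h; rewrite /chi step_eq0 ?mul0r// ltW.
split.
- by move=> x; case: (d x).
- rewrite dE => x; apply: cvgD; apply: cvgM.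
  + exact: dchi_continuous.
  + exact: (is_derive_continuous sd).
  + exact: chi_continuous.
  + exact: dsc.
- apply: (@subclosed_compact _ _ `[a, b]%classic).
  + exact: closed_closure.
  + exact: segment_compact.
  + by move=> x /SN /Nab /=; rewrite !in_itv/= => /andP[/ltW -> /ltW ->].
- move=> x /SN /Nab /=; rewrite !in_itv/= => /andP[xa xb].
  by rewrite (le_lt_trans a0 xa) (lt_le_trans xb b1).
Qed.

End cutoff.

(** * Testing a distributional derivative with functions vanishing at the end points *)
Section dct.
Context d (T : measurableType d) (R : realType).

Lemma Rintegral_dominated_cvg (m : {measure set T -> \bar R}) (D : set T)
    (f_ : nat -> T -> R) (f g : T -> R) : measurable D ->
  (forall n, measurable_fun D (f_ n)) -> measurable_fun D f ->
  (forall x, D x -> f_ n x @[n --> \oo] --> f x) ->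
  m.-integrable D (EFin \o g) ->
  (forall n x, D x -> `|f_ n x| <= g x) ->
  \int[m]_(x in D) f_ n x @[n --> \oo] --> \int[m]_(x in D) f x.
Proof.
move=> mD mf_ mf f_f ig f_g.
have [||||i _ h] := @dominated_convergence _ _ _ m D mD
  (fun n => EFin \o f_ n) (EFin \o f) (EFin \o g) _ _ _ ig.
- by move=> n; apply/measurable_EFinP; exact: mf_.
- by apply/measurable_EFinP.
- by apply: aeW => x Dx; apply: cvg_EFin; [exact: nearW|exact: f_f].
- by apply: aeW => x n Dx; rewrite /= lee_fin; exact: f_g.
apply: fine_cvg; rewrite fineK; first exact: h.
exact: integrable_fin_num.
Qed.

Lemma bounded_integrable (m : {measure set T -> \bar R}) (D : set T)
    (f : T -> R) (C : R) : measurable D -> (m D < +oo)%E -> measurable_fun D f ->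
  (forall x, D x -> `|f x| <= C) -> m.-integrable D (EFin \o f).
Proof.
move=> mD Doo mf fC; apply: measurable_bounded_integrable => //.
exists C; split; first exact: num_real.
by move=> y Cy x Dx; rewrite /= (le_trans (fC x Dx))// ltW.
Qed.

Lemma finite_measure_lty (m : {finite_measure set T -> \bar R}) (D : set T) :
  measurable D -> (m D < +oo)%E.
Proof. by move=> mD; rewrite ltey_eq fin_num_measure. Qed.

Lemma charge_Rintegral_dominated_cvg (nu : {charge set T -> \bar R}) (D : set T)
    (f_ : nat -> T -> R) (f : T -> R) (C : R) : measurable D ->
  (forall n, measurable_fun D (f_ n)) -> measurable_fun D f ->
  (forall x, D x -> f_ n x @[n --> \oo] --> f x) ->
  (forall n x, D x -> `|f_ n x| <= C) ->
  charge_Rintegral nu D (f_ n) @[n --> \oo] --> charge_Rintegral nu D f.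
Proof.
move=> mD mf_ mf f_f fC.
have iC (m : {finite_measure set T -> \bar R}) : m.-integrable D (EFin \o cst C).
  by apply: (bounded_integrable mD (finite_measure_lty m mD) (C := `|C|)).
by apply: cvgB; apply: (@Rintegral_dominated_cvg _ _ _ _ (cst C)) => //; exact: iC.
Qed.

End dct.

Section test.
Context {R : realType}.
Local Notation leb := (@lebesgue_measure R).
Local Notation I01 := (`]0%R, 1%R[%classic : set R).
Implicit Types (mu : {charge set (measurableTypeR R) -> \bar R}) (x y : R).

Lemma continuous_measurable_on (g : R -> R) (D : set R) : measurable D ->
  continuous g -> measurable_fun D g.
Proof. by move=> mD cg; apply: measurable_funTS; exact: continuous_measurable_fun. Qed.

Lemma continuous_bounded01 (h : R -> R) : continuous h ->
  exists2 C : R, 0 <= C & forall x, x \in `[0, 1] -> `|h x| <= C.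
Proof.
move=> hc.
have nc : continuous (fun x => `|h x|) by move=> x; exact: cvg_norm (hc x).
have [c _ hC] := EVT_max ler01 (continuous_subspaceT nc).
by exists `|h c|.
Qed.

(** A C1 function vanishing at 0 and 1 is bounded by a multiple of [x (1 - x)], as
the smaller of [x] and [1 - x] is at most [2 x (1 - x)]. *)
Lemma prim_parab_bound (h : R -> R) (C : R) : continuous h -> 0 <= C ->
  (forall x, x \in `[0, 1] -> `|h x| <= C) -> prim h 1 = 0 ->
  forall x, x \in `[0, 1] -> `|prim h x| <= 2 * C * parab 0 1 x.
Proof.
move=> hc C0 hC h1 x x01; have := x01; rewrite in_itv/= => /andP[x0 x1].
have d := @is_derive_mull R.
have b1 : `|prim h x| <= C * x.
  have hb y : y \in `[0, 1] -> - C <= h y <= C by move=> /hC; rewrite ler_norml.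
  by have := prim_bounds hc hb x01; rewrite mulNr ler_norml.
have b2 : `|prim h x| <= C * (1 - x).
  have sub y : y \in `[x, 1] -> y \in `[0, 1].
    by rewrite !in_itv/= => /andP[? ->]; rewrite (le_trans x0).
  have u1 := le_prim_increment hc (d C) x0 x1 (lexx 1) (fun y yx => le_trans (ler_norm _) (hC y (sub y yx))).
  have u2 : - C * 1 - - C * x <= prim h 1 - prim h x.
    apply: (ge_prim_increment hc (d (- C)) x0 x1 (lexx 1)) => y /sub /hC.
    by rewrite ler_norml => /andP[].
  rewrite ler_norml; move: u1 u2; rewrite h1; move=> *; apply/andP; split; lra.
rewrite /parab subr0.
have [xh|xh] := leP x (2^-1).
  apply: le_trans b1 _; have hx : 0 <= 1 - 2 * x by lra.
  by have := mulr_ge0 (mulr_ge0 C0 x0) hx; lra.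
apply: le_trans b2 _; have hx : 0 <= 2 * x - 1 by lra.
have x1' : 0 <= 1 - x by lra.
by have := mulr_ge0 (mulr_ge0 C0 x1') hx; lra.
Qed.

(** The identity defining the derivative extends from compactly supported test
functions to [prim h], which merely vanishes at 0 and 1. The functions
[chi 0 1 n * prim h] are admissible; they converge boundedly to [prim h], and
their derivatives converge boundedly to [h] since [dchi] is compensated by the
decay of [prim h] at the end points. *)
Lemma distr_derivative_prim (w : R -> R) mu (h : R -> R) :
  leb.-integrable I01 (EFin \o w) -> is_distr_derivative w mu ->
  continuous h -> prim h 1 = 0 ->
  \int[leb]_(x in I01) (w x * h x) = - charge_Rintegral mu I01 (prim h).
Proof.
move=> iw dw hc h1.
have mI : measurable I01 by exact: measurable_itv.
have sub x : I01 x -> x \in `[0, 1].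
  by rewrite /= !in_itv/= => /andP[/ltW -> /ltW ->].
have [C C0 hC] := continuous_bounded01 hc.
have sC := prim_parab_bound hc C0 hC h1.
pose s := prim h; pose ds x := plateau x * h x.
have sd : forall x : R, is_derive x 1 s (ds x) := is_derive_prim hc.
have dsc : continuous ds.
  by move=> x; apply: cvgM; [exact: plateau_continuous|exact: hc].
have sc : continuous s := is_derive_continuous sd.
have mw : measurable_fun I01 w by apply/measurable_EFinP; exact: measurable_int iw.
pose ph n x := chi 0 1 n x * s x.
pose dph n x := dchi 0 1 n x * s x + chi 0 1 n x * ds x.
have phP n := @C1_compact_support_chi R 0 1 n s ds (lexx 0) ler01 (lexx 1) sd dsc.
have cph n : continuous (ph n).
  by move=> x; apply: cvgM; [exact: chi_continuous|exact: sc].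
have cdph n : continuous (dph n).
  move=> x; apply: cvgD; apply: cvgM.
  - exact: dchi_continuous.
  - exact: sc.
  - exact: chi_continuous.
  - exact: dsc.
have E n : \int[leb]_(x in I01) (w x * dph n x) = - charge_Rintegral mu I01 (ph n).
  by have [p1 p2] := phP n; have := dw _ p1; rewrite p2.
have par01 x : I01 x -> 0 <= parab 0 1 x <= 1.
  by rewrite /= in_itv/= /parab => /andP[x0 x1]; apply/andP; split; nra.
have chi01 n x : 0 <= chi 0 1 n x <= 1 by exact: step_itv.
(* one bound provides both the convergence and the domination *)
have dist n x : I01 x -> `|dph n x - h x| <= 9 * C * (1 - chi 0 1 n x).
  move=> Ix; have x01 := sub x Ix.
  have -> : dph n x - h x = dchi 0 1 n x * s x - (1 - chi 0 1 n x) * h x.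
    by rewrite /dph /ds plateau1//; ring.
  have /andP[c0 c1] := chi01 n x.
  apply: le_trans (ler_normB _ _) _.
  have t2 : `|(1 - chi 0 1 n x) * h x| <= C * (1 - chi 0 1 n x).
    rewrite normrM ger0_norm ?subr_ge0// mulrC; apply: ler_wpM2r; first by rewrite subr_ge0.
    exact: hC.
  have t1 : `|dchi 0 1 n x * s x| <= 8 * C * (1 - chi 0 1 n x).
    have db := dstep_bound (n%:R * parab 0 1 x).
    have D0 := dstep_ge0 (n%:R * parab 0 1 x).
    rewrite /dchi; set D := dstep _ in db D0 *; set P := parab 0 1 x in db *.
    have n0 : 0 <= n%:R :> R by [].
    have P0 : 0 <= P by have /andP[] := par01 x Ix.
    have a1 : `|0 + 1 - 2 * x| <= 1.
      by move: x01; rewrite in_itv/= => /andP[? ?]; rewrite ler_norml; apply/andP; split; lra.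
    rewrite normrM (normrM D) (normrM n%:R) (ger0_norm D0) (ger0_norm n0).
    apply: (@le_trans _ _ (D * (n%:R * 1) * (2 * C * P))).
      apply: ler_pM => //; first by apply: mulr_ge0 => //; apply: mulr_ge0.
        by apply: ler_wpM2l => //; apply: ler_wpM2l.
      exact: sC.
    have -> : D * (n%:R * 1) * (2 * C * P) = 2 * C * (n%:R * P * D) by ring.
    have -> : 8 * C * (1 - chi 0 1 n x) = 2 * C * (4 * (1 - chi 0 1 n x)) by ring.
    by apply: ler_wpM2l; rewrite ?mulr_ge0.
  lra.
have cvgchi x : I01 x -> chi 0 1 n x @[n --> \oo] --> (1 : R).
  by move=> Ix; apply: chi_cvg.
have l1 : \int[leb]_(x in I01) (w x * dph n x) @[n --> \oo] --> \int[leb]_(x in I01) (w x * h x).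
  apply: (@Rintegral_dominated_cvg _ _ R leb I01 (fun n x => w x * dph n x) (fun x => w x * h x) (fun x => 10 * C * `|w x|)) => //.
  - move=> n; apply: measurable_funM => //; exact: continuous_measurable_on.
  - by apply: measurable_funM => //; exact: continuous_measurable_on.
  - move=> x Ix; apply: cvgMr; apply/cvgrPdist_le => e e0.
    have : 9 * C * (1 - chi 0 1 n x) @[n --> \oo] --> 9 * C * (1 - 1).
      by apply: cvgMr; apply: cvgB; [exact: cvg_cst|exact: cvgchi].
    rewrite subrr mulr0 => /cvgr0Pnorm_le /(_ _ e0).
    apply: filterS => n; rewrite distrC => hn; apply: le_trans (dist n x Ix) _.
    exact: le_trans (ler_norm _) hn.
  - have : leb.-integrable I01 (fun x => (10 * C)%:E * (abse \o (EFin \o w)) x)%E.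
      by apply: integrableZl => //; exact: integrable_abse.
    by congr (integrable _ _ _).
  - move=> n x Ix; rewrite normrM mulrC; apply: ler_wpM2r => //.
    have -> : dph n x = (dph n x - h x) + h x by ring.
    apply: le_trans (ler_normD _ _) _.
    have := dist n x Ix; have := hC x (sub x Ix); have /andP[c0 c1] := chi01 n x.
    nra.
have l2 : - charge_Rintegral mu I01 (ph n) @[n --> \oo] --> - charge_Rintegral mu I01 s.
  apply: cvgN; apply: (@charge_Rintegral_dominated_cvg _ _ R mu I01 ph s (2 * C)) => //.
  - by move=> n; exact: continuous_measurable_on.
  - exact: continuous_measurable_on.
  - move=> x Ix; rewrite -[X in _ --> X]mul1r; apply: cvgMl; exact: cvgchi.
  - move=> n x Ix; rewrite normrM.
    have /andP[c0 c1] := chi01 n x; rewrite ger0_norm//.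
    have := sC x (sub x Ix); have /andP[p0 p1] := par01 x Ix => hs.
    have : `|s x| <= 2 * C.
      by apply: le_trans hs _; rewrite ler_piMr// mulr_ge0.
    have := normr_ge0 (s x); nra.
have e12 : (fun n => \int[leb]_(x in I01) (w x * dph n x)) = (fun n => - charge_Rintegral mu I01 (ph n)).
  by apply/funext => n; exact: E.
rewrite e12 in l1.
exact: (cvg_unique _ l1 l2).
Qed.

End test.

(** * Integration against charges *)
Section charge_integral.
Context d (T : measurableType d) (R : realType).
Implicit Types (mu nu ga : {charge set T -> \bar R}) (A D : set T) (phi k : T -> R).

Local Notation pos nu := (jordan_pos (hahn_posneg nu)).
Local Notation neg nu := (jordan_neg (hahn_posneg nu)).

Lemma hahn_pos_measurable nu : measurable (hahn_pos nu).
Proof. by have [[]] := hahn_posneg nu. Qed.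

Lemma hahn_neg_measurable nu : measurable (hahn_neg nu).
Proof. by have [_ []] := hahn_posneg nu. Qed.

Lemma hahn_jordan_posE nu A : measurable A -> pos nu A = nu (A `&` hahn_pos nu).
Proof. by move=> mA; rewrite jordan_posE charge.cjordan_posE /crestr0 mem_set. Qed.

Lemma hahn_jordan_negE nu A : measurable A -> neg nu A = (- nu (A `&` hahn_neg nu))%E.
Proof. by move=> mA; rewrite jordan_negE cjordan_negE /crestr0 mem_set. Qed.

Lemma hahn_jordanE nu A : measurable A -> nu A = (pos nu A - neg nu A)%E.
Proof.
by move=> mA; rewrite (jordan_decomp (hahn_posneg nu) mA) /cadd/= cscaleN1.
Qed.

Lemma measure_add_apply (m1 m2 : {measure set T -> \bar R}) A :
  (measure_add m1 m2 : {measure set T -> \bar R}) A = (m1 A + m2 A)%E.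
Proof. exact: measure_addE. Qed.

Lemma Rintegral_measure_add (m1 m2 : {measure set T -> \bar R}) D phi (C : R) :
  measurable D -> measurable_fun D phi -> (forall x, D x -> `|phi x| <= C) ->
  (m1 D < +oo)%E -> (m2 D < +oo)%E ->
  \int[measure_add m1 m2]_(x in D) phi x =
  \int[m1]_(x in D) phi x + \int[m2]_(x in D) phi x.
Proof.
move=> mD mphi phiC m1oo m2oo.
have i1 := bounded_integrable mD m1oo mphi phiC.
have i2 := bounded_integrable mD m2oo mphi phiC.
rewrite /Rintegral (integral_measure_add mD i1 i2) fineD//.
- exact: integrable_fin_num.
- exact: integrable_fin_num.
Qed.

Lemma fin_num_rearrange (a b c e f g : \bar R) :
  a \is a fin_num -> b \is a fin_num -> c \is a fin_num ->
  e \is a fin_num -> f \is a fin_num -> g \is a fin_num ->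
  (a - b = (c - e) + (f - g) -> a + (e + g) = b + (c + f))%E.
Proof.
move: a b c e f g => [a||] [b||] [c||] [e||] [f||] [g||]// _ _ _ _ _ _.
by rewrite -!EFinD => -[h]; congr EFin; lra.
Qed.

(** Moving the negative parts to the other side turns the hypothesis into an
equality of sums of finite measures, whatever Hahn decompositions are used. *)
Lemma charge_Rintegral_add mu ga nu D phi (C : R) :
  measurable D -> measurable_fun D phi -> (forall x, D x -> `|phi x| <= C) ->
  (forall A, measurable A -> A `<=` D -> mu A = (ga A + nu A)%E) ->
  charge_Rintegral mu D phi = charge_Rintegral ga D phi + charge_Rintegral nu D phi.
Proof.
move=> mD mphi phiC E.
have fin (m : {finite_measure set T -> \bar R}) := finite_measure_lty m mD.
have add3 (a b c : {finite_measure set T -> \bar R}) :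
    \int[measure_add a (measure_add b c)]_(x in D) phi x =
    \int[a]_(x in D) phi x + (\int[b]_(x in D) phi x + \int[c]_(x in D) phi x).
  rewrite (Rintegral_measure_add mD mphi phiC (fin a)).
    by rewrite (Rintegral_measure_add mD mphi phiC (fin b) (fin c)).
  by rewrite measure_add_apply lte_add_pinfty ?fin.
have h : \int[measure_add (pos mu) (measure_add (neg ga) (neg nu))]_(x in D) phi x =
    \int[measure_add (neg mu) (measure_add (pos ga) (pos nu))]_(x in D) phi x.
  rewrite /Rintegral; congr fine; apply: eq_measure_integral => A mA AD.
  rewrite !measure_add_apply; have := E A mA AD.
  rewrite (hahn_jordanE mu mA) (hahn_jordanE ga mA) (hahn_jordanE nu mA).
  by apply: fin_num_rearrange; rewrite fin_num_measure.
rewrite !add3 in h; rewrite /charge_Rintegral; lra.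
Qed.

(** [k] is almost everywhere the Radon-Nikodym derivative of [al], for which the
change of variables formula is known. *)
Lemma finite_measure_density (m : {sigma_finite_measure set T -> \bar R})
    (al : {finite_measure set T -> \bar R}) (k : T -> \bar R) D phi (C : R) :
  m.-integrable setT k ->
  (forall A, measurable A -> al A = (\int[m]_(x in A) k x)%E) ->
  measurable D -> measurable_fun D phi -> (forall x, D x -> `|phi x| <= C) ->
  (\int[al]_(x in D) (phi x)%:E = \int[m]_(x in D) ((phi x)%:E * k x))%E.
Proof.
move=> ik alk mD mphi phiC.
have mk : measurable_fun setT k := measurable_int _ ik.
have dom : al `<< m.
  apply/null_content_dominatesP => A mA mA0; rewrite alk//.
  by apply: null_set_integral => //; exact: measurable_funTS.
have iphi : al.-integrable D (EFin \o phi).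
  exact: (bounded_integrable mD (finite_measure_lty al mD) mphi phiC).
rewrite -(Radon_Nikodym_change_of_variables dom mD iphi).
have mE : measurable_fun D (EFin \o phi) by apply/measurable_EFinP.
have iRN : m.-integrable setT (Radon_Nikodym (charge_of_finite_measure al) m).
  exact: Radon_Nikodym_integrable.
apply: ae_eq_integral => //.
- apply: emeasurable_funM => //; apply: measurable_funTS; exact: measurable_int iRN.
- by apply: emeasurable_funM => //; apply: measurable_funTS.
- apply: ae_eqe_mul2l; apply: integral_ae_eq => //.
  + exact: integrableS iRN.
  + exact: measurable_funTS.
  + move=> A AD mA; rewrite -alk// -Radon_Nikodym_integral//.
Qed.

Lemma charge_Rintegral_induced (m : {sigma_finite_measure set T -> \bar R}) k D phi (C : R)
    (ik : m.-integrable setT (EFin \o k)) :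
  measurable D -> measurable_fun D phi -> (forall x, D x -> `|phi x| <= C) ->
  charge_Rintegral (induced_charge ik) D phi = \int[m]_(x in D) (phi x * k x).
Proof.
move=> mD mphi phiC; set ga : {charge set T -> \bar R} := induced_charge ik.
have mk : measurable_fun setT k by apply/measurable_EFinP; exact: measurable_int ik.
have ipat (B : set T) : measurable B -> m.-integrable setT (EFin \o (k \_ B)).
  by move=> mB; rewrite -restrict_EFin; apply/integrable_restrict => //; rewrite setTI; exact: (integrableS measurableT mB _ ik).
have [_ _ PNT PN0] := hahn_posneg ga.
have mP := hahn_pos_measurable ga; have mN := hahn_neg_measurable ga.
have iprod (B : set T) : measurable B -> m.-integrable D (EFin \o (fun x => phi x * (k \_ B) x)).
  move=> mB.
  have : m.-integrable D ((EFin \o phi) \* (EFin \o (k \_ B)))%E.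
    apply: integrableMr => //; last exact: integrableS (ipat B mB).
    exists C; split; first exact: num_real.
    by move=> y Cy x Dx; rewrite /= (le_trans (phiC x Dx))// ltW.
  by congr (integrable _ _ _).
have hp : \int[pos ga]_(x in D) phi x = \int[m]_(x in D) (phi x * (k \_ (hahn_pos ga)) x).
  rewrite /Rintegral (@finite_measure_density m (pos ga) (EFin \o (k \_ (hahn_pos ga))) D phi C)//.
    exact: ipat.
  move=> A mA; transitivity (ga (A `&` hahn_pos ga)); first exact: hahn_jordan_posE.
  by rewrite -restrict_EFin -integral_mkcondr.
have hn : \int[neg ga]_(x in D) phi x = - \int[m]_(x in D) (phi x * (k \_ (hahn_neg ga)) x).
  rewrite /Rintegral (@finite_measure_density m (neg ga) (fun x => - (EFin \o (k \_ (hahn_neg ga))) x)%E D phi C)//.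
  - rewrite -fineN; congr fine; rewrite -integralN.
      by apply: eq_integral => x _; rewrite muleN.
    by apply: integrable_add_def => //; exact: iprod.
  - by apply: integrableN; exact: ipat.
  - move=> A mA; transitivity (- ga (A `&` hahn_neg ga))%E; first exact: hahn_jordan_negE.
    rewrite integralN; first by rewrite -restrict_EFin -integral_mkcondr.
    apply: integrable_add_def => //; apply: (integrableS measurableT mA) => //.
    exact: ipat.
rewrite /charge_Rintegral hp hn opprK -RintegralD//; [|exact: iprod..].
apply: eq_Rintegral => x _; rewrite -mulrDr; congr (_ * _).
rewrite !patchE.
have [xP|xP] := boolP (x \in hahn_pos ga); have [xN|xN] := boolP (x \in hahn_neg ga).
- have h : (hahn_pos ga `&` hahn_neg ga) x by split; exact: set_mem.
  by rewrite PN0 in h.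
- by rewrite addr0.
- by rewrite add0r.
- have : (hahn_pos ga `|` hahn_neg ga) x by rewrite PNT.
  by move=> [] /mem_set h; rewrite h in xP xN.
Qed.

End charge_integral.

(** * Charges on (0,1) are determined by test functions *)
Section uniqueness.
Context {R : realType}.
Local Notation leb := (@lebesgue_measure R).
Local Notation I01 := (`]0%R, 1%R[%classic : set R).
Local Notation TR := (measurableTypeR R).
Implicit Types (mu nu : {charge set TR -> \bar R}) (A : set TR).
Local Notation pos nu := (jordan_pos (hahn_posneg nu)).
Local Notation neg nu := (jordan_neg (hahn_posneg nu)).

Lemma charge_Rintegral_indic mu (D B : set TR) : measurable D -> measurable B ->
  charge_Rintegral mu D (\1_B : R -> R) = fine (mu (B `&` D)).
Proof.
move=> mD mB; rewrite /charge_Rintegral /Rintegral !integral_indic//.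
have mBD := measurableI _ _ mB mD.
by rewrite (hahn_jordanE mu mBD) fineB// fin_num_measure.
Qed.

Lemma charge_eq_itv mu nu (a b : R) : 0 <= a -> a <= b -> b <= 1 ->
  (forall phi, C1_compact_support phi ->
    charge_Rintegral mu I01 phi = charge_Rintegral nu I01 phi) ->
  mu `]a, b[%classic = nu `]a, b[%classic.
Proof.
move=> a0 ab b1 E.
have mI : measurable (I01 : set TR) by exact: measurable_itv.
have mab : measurable (`]a, b[%classic : set TR) by exact: measurable_itv.
have sub : `]a, b[%classic `<=` I01.
  by move=> x /=; rewrite !in_itv/= => /andP[ax xb]; rewrite (le_lt_trans a0 ax) (lt_le_trans xb b1).
have lim (ga : {charge set TR -> \bar R}) :
    charge_Rintegral ga I01 (chi a b n) @[n --> \oo] --> fine (ga `]a, b[%classic).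
  have := charge_Rintegral_indic ga mI mab; rewrite setIidl// => <-.
  apply: (@charge_Rintegral_dominated_cvg _ _ R ga I01 (chi a b) (\1_(`]a, b[%classic)) 1) => //.
  - by move=> n; apply: continuous_measurable_on => //; exact: chi_continuous.
  - move=> x _; rewrite indicE; have [xab|xab] := boolP (x \in (`]a, b[%classic : set R)).
      by apply: chi_cvg; rewrite inE in xab.
    rewrite (_ : (fun n => chi a b n x) = fun=> 0); first exact: cvg_cst.
    apply/funext => n; apply: chi_out => //; apply: contraNN xab => h; by rewrite inE.
  - by move=> n x _; have /andP[c0 c1] : 0 <= chi a b n x <= 1 := step_itv _; rewrite ger0_norm.
have chiE n : charge_Rintegral mu I01 (chi a b n) = charge_Rintegral nu I01 (chi a b n).
  have d (x : R) : is_derive x 1 (cst 1 : R -> R) ((cst 0 : R -> R) x) by exact: is_derive_cst.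
  have c : continuous (cst 0 : R -> R) by move=> x; exact: cvg_cst.
  have [h _] := C1_compact_support_chi n a0 ab b1 d c.
  rewrite (_ : chi a b n = (fun x => chi a b n x * cst 1 x)); first exact: E.
  by apply/funext => x /=; rewrite mulr1.
have l1 := lim mu; have l2 := lim nu.
have e : (fun n => charge_Rintegral mu I01 (chi a b n)) = (fun n => charge_Rintegral nu I01 (chi a b n)).
  exact/funext.
rewrite e in l1; have := cvg_unique _ l1 l2 => h.
rewrite -[LHS]fineK ?fin_num_measure// -[RHS]fineK ?fin_num_measure//; congr EFin; exact: h.
Qed.

Lemma fin_num_subr_eq (a b c e : \bar R) :
  a \is a fin_num -> b \is a fin_num -> c \is a fin_num -> e \is a fin_num ->
  (a - b = c - e <-> a + e = b + c)%E.
Proof.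
move: a b c e => [a||] [b||] [c||] [e||]// _ _ _ _.
by rewrite -!EFinD; split=> -[h]; congr EFin; lra.
Qed.

(** By [charge_eq_itv] the two charges agree on the open subintervals of (0,1), the
traces of a pi-system that generates the Borel sets. The uniqueness theorem for
measures is applied to positive parts plus opposite negative parts. *)
Lemma charge_eq_of_test mu nu :
  (forall phi, C1_compact_support phi ->
    charge_Rintegral mu I01 phi = charge_Rintegral nu I01 phi) ->
  forall A, measurable A -> A `<=` I01 -> mu A = nu A.
Proof.
move=> E A mA AI.
have mI : measurable (I01 : set TR) by exact: measurable_itv.
pose m1 : {measure set TR -> \bar R} := measure_add (pos mu) (neg nu).
pose m2 : {measure set TR -> \bar R} := measure_add (neg mu) (pos nu).
have m12 (B : set TR) : measurable B -> mu B = nu B <-> m1 B = m2 B.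
  move=> mB; rewrite (hahn_jordanE mu mB) (hahn_jordanE nu mB) /m1 /m2 !measure_add_apply.
  by apply: fin_num_subr_eq; rewrite fin_num_measure.
apply/m12 => //.
have fin (m m' : {finite_measure set TR -> \bar R}) (B : set TR) : measurable B ->
   ((measure_add m m' : {measure set TR -> \bar R}) B < +oo)%E.
  by move=> mB; rewrite measure_add_apply ltey_eq fin_numD !fin_num_measure.
suff : mrestr m1 mI A = mrestr m2 mI A by rewrite /mrestr/= setIidl.
apply: (@measure_unique _ R TR (@RGenOInfty.G R) (fun n => `]- n%:R, +oo[%classic)) => //.
- exact: RGenOInfty.measurableE.
- move=> _ _ [x ->] [y ->]; exists (Num.max x y).
  apply/seteqP; split => z /=; rewrite !in_itv/= !andbT gt_max.
    by move=> [-> ->].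
  by move=> /andP[-> ->].
- by move=> n; exists (- n%:R).
- apply/seteqP; split => // x _; exists (Num.truncn `|x|).+1 => //=.
  rewrite in_itv/= andbT ltrNl; apply: le_lt_trans (ler_norm _) _.
  by rewrite normrN truncnS_gt.
- move=> _ [x ->].
  change (m1 (`]x, +oo[%classic `&` I01) = m2 (`]x, +oo[%classic `&` I01)).
  have [x1|x1] := leP 1 (Num.max x 0).
    have -> : `]x, +oo[%classic `&` I01 = set0 :> set R.
      apply/seteqP; split => y //=; rewrite !in_itv/= ?andbT => -[xy /andP[y0 y1]].
      by move: x1; rewrite leNgt gt_max (lt_trans xy y1) ltr01.
    by rewrite !measure0.
  have -> : `]x, +oo[%classic `&` I01 = `]Num.max x 0, 1[%classic :> set R.
    apply/seteqP; split => y /=; rewrite !in_itv/= ?andbT gt_max.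
      by move=> [xy /andP[y0 y1]]; rewrite xy y0 y1.
    by move=> /andP[/andP[xy y0] y1]; rewrite xy y0 y1.
  apply/m12; first exact: measurable_itv.
  by apply: charge_eq_itv => //; [rewrite le_max lexx orbT|exact: ltW].
- move=> n; rewrite /mrestr; apply: fin; exact: measurableI.
Qed.

End uniqueness.

(** * The Lebesgue decomposition *)
Section lebesgue.
Context {R : realType}.
Local Notation leb := (@lebesgue_measure R).
Local Notation I01 := (`]0%R, 1%R[%classic : set R).
Local Notation TR := (measurableTypeR R).
Implicit Types (mu nu : {charge set TR -> \bar R}) (A : set TR).

Lemma choose_orP {T : Type} (P : set T) (x0 : T) : (exists x, P x) -> P (choose_or P x0).
Proof. by rewrite /choose_or; case: pselect => // h _; exact: svalP (cid h). Qed.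

Lemma total_varE mu A : measurable A ->
  total_var mu A = (mu (A `&` hahn_pos mu) - mu (A `&` hahn_neg mu))%E.
Proof. by move=> mA; rewrite /total_var /charge_variation /= hahn_jordan_posE// hahn_jordan_negE. Qed.

Lemma total_var_eq0 mu A : measurable A ->
  (forall B, measurable B -> B `<=` A -> mu B = 0) -> total_var mu A = 0%E.
Proof.
move=> mA A0; rewrite total_varE// !A0 ?sube0//.
- exact/measurableI/hahn_neg_measurable.
- exact/measurableI/hahn_pos_measurable.
Qed.

Lemma total_var_eq0_sub mu A B : measurable A -> measurable B -> B `<=` A ->
  total_var mu A = 0%E -> mu B = 0%E.
Proof.
move=> mA mB BA A0; apply/eqP; rewrite -abse_eq0 eq_le abse_ge0 andbT.
apply: le_trans (abse_charge_variation (hahn_posneg mu) mB) _.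
rewrite -A0 /total_var; apply: le_measure => //; exact/mem_set.
Qed.

(** Among the Lebesgue-null sets one carries the largest variation, namely the
union of a maximizing sequence. A null set disjoint from it has no variation,
since otherwise it could be added. *)
Lemma max_null_set mu : exists2 N : set TR, measurable N /\ leb N = 0%E &
  forall B, measurable B -> leb B = 0%E -> B `&` N = set0 -> total_var mu B = 0%E.
Proof.
pose tv : {measure set TR -> \bar R} := charge_variation (hahn_posneg mu).
have tvfin B : measurable B -> tv B \is a fin_num.
  by move=> mB; rewrite /tv /= /charge_variation fin_numD !fin_num_measure.
pose ftv (B : set TR) : R := fine (tv B).
have tvle B C : measurable B -> measurable C -> B `<=` C -> ftv B <= ftv C.
  by move=> mB mC BC; rewrite /ftv fine_le ?tvfin//; apply: le_measure => //; exact/mem_set.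
pose S := [set x : R | exists N : set TR, [/\ measurable N, leb N = 0%E & x = ftv N]].
have hS : has_sup S.
  split; first by exists (ftv set0), set0; split => //; rewrite measure0.
  by exists (ftv setT) => _ [N [mN _ ->]]; exact: tvle.
have hn n : exists N : set TR, [/\ measurable N, leb N = 0%E & sup S - n.+1%:R^-1 < ftv N].
  have e0 : 0 < n.+1%:R^-1 :> R by rewrite invr_gt0.
  have [_ [N [mN N0 ->]] h] := sup_adherent e0 hS.
  by exists N.
have [N_ NP] := choice hn.
pose N := \bigcup_n N_ n.
have mN : measurable N by apply: bigcup_measurable => n _; case: (NP n).
have N0 : leb N = 0%E.
  apply: measure_negligible => //; apply: negligible_bigcup => n.
  by have [mNn Nn0 _] := NP n; apply/negligibleP.
have supN : sup S <= ftv N.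
  rewrite leNgt; apply/negP => h.
  have [n _ hn'] : \forall n \near \oo, n.+1%:R^-1 < sup S - ftv N.
    have p0 : 0 < sup S - ftv N by rewrite subr_gt0.
    exact: (near_infty_natSinv_lt (PosNum p0)).
  have h1 : n.+1%:R^-1 < sup S - ftv N := hn' n (leqnn n).
  have [mNn _ h2] := NP n.
  have h3 : ftv (N_ n) <= ftv N := tvle _ _ mNn mN (fun x Nx => ex_intro2 _ _ n I Nx).
  by move: h h1 h2 h3; set e := _^-1; lra.
exists N => // B mB B0 BN.
have mBN : measurable (B `|` N) by exact: measurableU.
have BN0 : leb (B `|` N) = 0%E.
  by apply: measure_negligible => //; apply: negligibleU; apply/negligibleP.
have h : ftv (B `|` N) <= sup S.
  by apply: sup_upper_bound => //; exists (B `|` N).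
move: h; rewrite /ftv measureU// fineD ?tvfin//; move: supN; rewrite /ftv => /[swap] h /(le_trans h).
move=> r0; have {}r0 : ftv B + ftv N <= ftv N := r0.
have r1 : ftv B <= 0 by lra.
rewrite -[total_var mu B]/(tv B) -(fineK (tvfin _ mB)); congr EFin.
by apply/eqP; rewrite eq_le r1 fine_ge0.
Qed.

(** The singular part is the restriction to a maximal null set; the remainder is
absolutely continuous and has a density by the Radon-Nikodym theorem. *)
Lemma lebesgue_decomposition_exists mu : exists p, is_lebesgue_decomposition mu p.1 p.2.
Proof.
have [N [mN N0] NP] := max_null_set mu.
pose nu : {charge set TR -> \bar R} := crestr mu mN.
pose rest : {charge set TR -> \bar R} := crestr mu (measurableC mN).
have dom : rest `<< leb.
  apply/null_content_dominatesP => A mA A0.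
  have mAN : measurable (A `&` ~` N) by apply: measurableI => //; exact: measurableC.
  apply: (total_var_eq0_sub mAN mAN) => //; apply: NP => //; last by rewrite -setIA setICl setI0.
  apply/eqP; rewrite eq_le measure_ge0 andbT -A0.
  by apply: le_measure => //; exact/mem_set.
pose g x := fine (Radon_Nikodym rest leb x).
have gE : EFin \o g = Radon_Nikodym rest leb.
  by apply/funext => x; rewrite /g /= fineK// Radon_Nikodym_fin_num.
have ig : leb.-integrable setT (EFin \o g) by rewrite gE; exact: Radon_Nikodym_integrable.
exists (g, nu); split => /=.
- exact: (integrableS measurableT _ _ ig).
- exists N => //; apply: total_var_eq0; first exact: measurableD.
  move=> B mB BN; rewrite /nu/= /crestr.
  rewrite (_ : B `&` N = set0) ?charge0//.
  by apply/seteqP; split => x // [/BN [_]].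
- move=> A mA AI.
  have -> : (\int[leb]_(x in A) (g x)%:E)%E = rest A.
    rewrite (Radon_Nikodym_integral dom mA); apply: eq_integral => x _.
    by rewrite -gE.
  rewrite /rest /nu /= /crestr; rewrite [LHS](chargeDI mu mA mN) setDE.
  by [].
Qed.

(** Off the null set that carries [nu], both [p] and [g] are densities of [mu], so
that they agree almost everywhere; then nothing is left for [nu]. *)
Lemma lebesgue_decomposition_unique mu (p g : R -> R) nu :
  leb.-integrable I01 (EFin \o p) ->
  (forall A, measurable A -> A `<=` I01 -> mu A = (\int[leb]_(x in A) (p x)%:E)%E) ->
  is_lebesgue_decomposition mu g nu ->
  ae_eq leb I01 g p /\ total_var nu I01 = 0%E.
Proof.
move=> ip mup [ig [N [mN N0] nuN] dec].
have mI : measurable (I01 : set TR) by exact: measurable_itv.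
have mIN : measurable (I01 `\` N) by exact: measurableD.
have fing A : measurable A -> A `<=` I01 -> (\int[leb]_(x in A) (g x)%:E)%E \is a fin_num.
  by move=> mA AI; have h := integrableS mI mA AI ig; exact: integrable_fin_num.
have aeN : ae_eq leb (I01 `\` N) (EFin \o g) (EFin \o p).
  apply: integral_ae_eq => //.
  - by apply: (integrableS mI mIN _ ig); exact: subDsetl.
  - by apply: (measurable_funS mI (@subDsetl _ _ _)); exact: measurable_int ip.
  - move=> E EIN mE; have EI : E `<=` I01 by apply: subset_trans EIN _; exact: subDsetl.
    have := dec E mE EI; rewrite (total_var_eq0_sub mIN mE EIN nuN) adde0 => <-.
    exact: mup.
have ae : ae_eq leb I01 g p.
  have hN : {ae leb, forall x, ~ N x}.
    by exists N; split => // x /=; apply: contrapT.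
  move: aeN hN; apply: filterS2 => x h nx Ix.
  by have := h (conj Ix nx) => /= -[].
split => //; apply: total_var_eq0 => // B mB BI.
have := dec B mB BI; rewrite (mup B mB BI) => h.
have e : (\int[leb]_(x in B) (p x)%:E = \int[leb]_(x in B) (g x)%:E)%E.
  apply: ae_eq_integral => //.
  - by apply: (measurable_funS mI BI); exact: measurable_int ip.
  - by apply: (measurable_funS mI BI); exact: measurable_int ig.
  - by move: ae; apply: filterS => x hx Bx; rewrite hx//; exact: BI.
move: h; rewrite e; have := fing B mB BI.
have : nu B \is a fin_num by rewrite fin_num_measure.
case: (nu B) => [r| |]//; case: (integral _ _ _) => [s| |]// _ _ [].
by move=> h; congr EFin; lra.
Qed.

End lebesgue.

(** * Smooth functions as elements of BV(0,1) *)
Section smooth.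
Context {R : realType}.
Local Notation leb := (@lebesgue_measure R).
Local Notation I01 := (`]0%R, 1%R[%classic : set R).
Local Notation TR := (measurableTypeR R).
Implicit Types (mu nu : {charge set TR -> \bar R}) (A : set TR).

Lemma measurable_I01 : measurable (I01 : set TR).
Proof. exact: measurable_itv. Qed.

Lemma continuous_integrable01 (g : R -> R) : continuous g -> leb.-integrable I01 (EFin \o g).
Proof.
move=> cg; apply: (@integrableS _ _ R leb `[0, 1]%classic) => //.
  by move=> x /=; rewrite !in_itv/= => /andP[/ltW -> /ltW ->].
by apply: continuous_compact_integrable; [exact: segment_compact|exact: continuous_subspaceT].
Qed.

Lemma Rintegral_oo_cc (g : R -> R) : continuous g ->
  \int[leb]_(x in I01) g x = \int[leb]_(x in `[0, 1]) g x.
Proof.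
move=> cg; have ig := continuous_integrable01 cg.
rewrite Rintegral_itv_bndo_bndc//.
apply: Rintegral_itv_obnd_cbnd.
apply: (@integrableS _ _ R leb `[0, 1]%classic) => //.
  by move=> x /=; rewrite !in_itv/= => /andP[/ltW -> ->].
by apply: continuous_compact_integrable; [exact: segment_compact|exact: continuous_subspaceT].
Qed.

Lemma derive_oo_LRcontinuous (g dg : R -> R) : (forall x : R, is_derive x 1 g (dg x)) ->
  derivable_oo_LRcontinuous g 0 1.
Proof.
move=> gd; have gc := is_derive_continuous gd; split.
- by move=> x _; case: (gd x).
- exact/cvg_at_right_filter/gc.
- exact/cvg_at_left_filter/gc.
Qed.

Lemma by_parts01 (v dv phi : R -> R) : (forall x : R, is_derive x 1 v (dv x)) ->
  continuous dv -> C1_compact_support phi ->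
  \int[leb]_(x in I01) (v x * phi^`()%classic x) = - \int[leb]_(x in I01) (dv x * phi x).
Proof.
move=> vd dvc [phid dphic _ supp].
have pd (x : R) : is_derive x 1 phi (phi^`()%classic x) by apply: DeriveDef => //; rewrite derive1E.
have vc := is_derive_continuous vd; have phic := is_derive_continuous pd.
have out x : ~ I01 x -> phi x = 0.
  move=> nx; apply/eqP; apply: contrapT => /negP h; apply/nx/supp.
  exact: subset_closure.
have e0 : phi 0 = 0 by apply: out; rewrite /= in_itv/= ltxx.
have e1 : phi 1 = 0 by apply: out; rewrite /= in_itv/= ltxx andbF.
have c1 : continuous (fun x => v x * phi^`()%classic x).
  by move=> x; apply: cvgM; [exact: vc|exact: dphic].
have c2 : continuous (fun x => dv x * phi x).
  by move=> x; apply: cvgM; [exact: dvc|exact: phic].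
rewrite !Rintegral_oo_cc//.
rewrite (Rintegration_by_parts ltr01 (continuous_subspaceT dvc) (derive_oo_LRcontinuous vd) _
  (continuous_subspaceT dphic) (derive_oo_LRcontinuous pd) _).
- by rewrite e0 e1 !mulr0 subrr sub0r.
- by move=> x _; rewrite (is_derive_derive1 vd).
- by [].
Qed.

Lemma patch_integrable (p : R -> R) : leb.-integrable I01 (EFin \o p) ->
  leb.-integrable setT (EFin \o (p \_ I01)).
Proof.
move=> ip; rewrite -restrict_EFin; apply/integrable_restrict => //.
by rewrite setTI.
Qed.

(** The absolutely continuous charge [p dx] on (0,1), extended by 0 to the line. *)
Definition density_charge (p : R -> R) (ip : leb.-integrable I01 (EFin \o p)) :
  {charge set TR -> \bar R} := induced_charge (patch_integrable ip).

Lemma density_chargeE p (ip : leb.-integrable I01 (EFin \o p)) A :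
  measurable A -> A `<=` I01 -> density_charge ip A = (\int[leb]_(x in A) (p x)%:E)%E.
Proof.
move=> mA AI; rewrite /density_charge /= /induced_charge -restrict_EFin -integral_mkcondr.
by rewrite setIidl.
Qed.

Lemma density_charge_Rintegral p (ip : leb.-integrable I01 (EFin \o p)) (phi : R -> R) (C : R) :
  measurable_fun I01 phi -> (forall x, I01 x -> `|phi x| <= C) ->
  charge_Rintegral (density_charge ip) I01 phi = \int[leb]_(x in I01) (phi x * p x).
Proof.
move=> mphi phiC.
rewrite (charge_Rintegral_induced (patch_integrable ip) measurable_I01 mphi phiC).
by apply: eq_Rintegral => x xI; rewrite patchE xI.
Qed.

Lemma smooth_distr_derivative (v dv : R -> R) (ip : leb.-integrable I01 (EFin \o dv)) :
  (forall x : R, is_derive x 1 v (dv x)) -> continuous dv ->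
  is_distr_derivative v (density_charge ip).
Proof.
move=> vd dvc phi phiC1; rewrite (by_parts01 vd dvc phiC1); congr (- _).
have phic : continuous phi.
  have [phid _ _ _] := phiC1.
  by move=> x; apply/differentiable_continuous/derivable1_diffP; exact: phid.
have [C C0 hC] := continuous_bounded01 phic.
rewrite (@density_charge_Rintegral _ ip phi C).
- by apply: eq_Rintegral => x _; rewrite mulrC.
- exact: continuous_measurable_on measurable_I01 phic.
- by move=> x; rewrite /= in_itv/= => /andP[x0 x1]; apply: hC; rewrite in_itv/= !ltW.
Qed.

Lemma BV01_spec (w : R -> R) : BV01 w -> is_distr_derivative w (distr_derivative w) /\
  is_lebesgue_decomposition (distr_derivative w) (ac_density w) (singular_part w).
Proof.
move=> [_ ex]; split; first exact: (@choose_orP _ [set mu | is_distr_derivative w mu] czero ex).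
exact: (@choose_orP _ [set p | is_lebesgue_decomposition (distr_derivative w) p.1 p.2] _
  (lebesgue_decomposition_exists (distr_derivative w))).
Qed.

Lemma smooth_BV01 (v dv : R -> R) : (forall x : R, is_derive x 1 v (dv x)) -> continuous dv ->
  BV01 v.
Proof.
move=> vd dvc; split; first exact: (continuous_integrable01 (is_derive_continuous vd)).
exists (density_charge (continuous_integrable01 dvc)); exact: (smooth_distr_derivative _ vd dvc).
Qed.

Lemma smooth_ac_singular (v dv : R -> R) :
  (forall x : R, is_derive x 1 v (dv x)) -> continuous dv ->
  ae_eq leb I01 (ac_density v) dv /\ total_var (singular_part v) I01 = 0%E.
Proof.
move=> vd dvc; have ip := continuous_integrable01 dvc.
have [d1 dec] := BV01_spec (smooth_BV01 vd dvc).
suff E A : measurable A -> A `<=` I01 -> distr_derivative v A = (\int[leb]_(x in A) (dv x)%:E)%E.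
  exact: (lebesgue_decomposition_unique ip E dec).
move=> mA AI; rewrite -(density_chargeE ip mA AI); apply: charge_eq_of_test => // phi phiC1.
by apply: oppr_inj; rewrite -d1// -(smooth_distr_derivative ip vd dvc).
Qed.

End smooth.

(** * Convexity and the dual variable *)
Section minim.
Context {R : realType}.
Local Notation leb := (@lebesgue_measure R).
Local Notation I01 := (`]0%R, 1%R[%classic : set R).
Local Notation TR := (measurableTypeR R).
Implicit Types (mu nu : {charge set TR -> \bar R}) (A : set TR) (F f w u : R -> R).

Lemma condF_derive1_homo F x y : condF1 F -> condF4 F -> x <= y ->
  F^`()%classic x <= F^`()%classic y.
Proof.
move=> F1 F4 xy; have [_ F'd] := condF1_derive F1.
have d (z : R) : is_derive z 1 (cst 0 : R -> R) ((cst 0 : R -> R) z) by exact: is_derive_cst.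
have h : cst 0 y - cst 0 x <= F^`()%classic y - F^`()%classic x.
  by apply: (le_increment d F'd xy) => z _; exact/ltW/F4.
by move: h; rewrite /= subrr subr_ge0.
Qed.

(** The graph of [F] lies above its tangents because [F'] is monotone. *)
Lemma condF_tangent_le F x y : condF1 F -> condF4 F ->
  F x + F^`()%classic x * (y - x) <= F y.
Proof.
move=> F1 F4; have [Fd _] := condF1_derive F1.
have lin := @is_derive_mull R.
have [xy|/ltW yx] := leP x y.
  have h : F^`()%classic x * y - F^`()%classic x * x <= F y - F x.
    apply: (le_increment (lin _) Fd xy) => z; rewrite in_itv/= => /andP[xz _].
    exact: condF_derive1_homo.
  lra.
have h : F x - F y <= F^`()%classic x * x - F^`()%classic x * y.
  apply: (le_increment Fd (lin _) yx) => z; rewrite in_itv/= => /andP[_ zx].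
  exact: condF_derive1_homo.
lra.
Qed.

(** [F'] increases to [lambda_infty F] and is odd. *)
Lemma normr_derive1_le_lambda_infty F (nu1 p : R) : condF1 F -> condF2 F nu1 -> condF4 F ->
  `|F^`()%classic p| <= lambda_infty F.
Proof.
move=> F1 F2 F4.
have ub : has_ubound (range F^`()%classic).
  by exists nu1 => _ [x _ <-]; apply: le_trans (F2 x); exact: ler_norm.
have mono : {homo F^`()%classic : x y / x <= y}.
  by move=> x y xy; exact: condF_derive1_homo.
have E : lambda_infty F = sup (range F^`()%classic).
  by apply: cvg_lim => //; exact: nondecreasing_cvgr.
have le x : F^`()%classic x <= lambda_infty F.
  by rewrite E; apply: ub_le_sup => //; exists x.
rewrite ler_norml le andbT lerNl -condF1_odd//; exact: le.
Qed.

Lemma charge_Rintegral_le_total_var nu (phi : R -> R) (C : R) : 0 <= C ->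
  measurable_fun I01 phi -> (forall x, I01 x -> `|phi x| <= C) ->
  charge_Rintegral nu I01 phi <= C * fine (total_var nu I01).
Proof.
move=> C0 mphi phiC; have mI := @measurable_I01 R.
have fin (m : {finite_measure set TR -> \bar R}) := finite_measure_lty m mI.
have i (m : {finite_measure set TR -> \bar R}) : m.-integrable I01 (EFin \o phi).
  exact: (bounded_integrable mI (fin m) mphi phiC).
have iC (m : {finite_measure set TR -> \bar R}) : m.-integrable I01 (EFin \o cst C).
  by apply: (bounded_integrable mI (fin m) (C := `|C|)).
have bd (m : {finite_measure set TR -> \bar R}) :
    `|\int[m]_(x in I01) phi x| <= C * fine (m I01).
  rewrite -Rintegral_cst// ler_norml; apply/andP; split.
    rewrite -[leLHS]mulN1r -RintegralZl//.
      have iNC : m.-integrable I01 (EFin \o (fun=> -1 * C)).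
        have := integrableZl mI (-1) (iC m); by congr (integrable _ _ _).
      apply: (le_Rintegral mI iNC (i m)).
      by move=> x Ix; rewrite mulN1r; have := phiC x Ix; rewrite ler_norml => /andP[].
    exact: iC.
  apply: (le_Rintegral mI (i m) (iC m)).
  by move=> x Ix; apply: le_trans (phiC x Ix); exact: ler_norm.
rewrite /charge_Rintegral /total_var /charge_variation /= fineD ?fin_num_measure//.
rewrite mulrDr.
have := bd (jordan_pos (hahn_posneg nu)); have := bd (jordan_neg (hahn_posneg nu)).
rewrite !ler_norml => /andP[h1 _] /andP[_ h2]; lra.
Qed.

Lemma BV01_integral_prim w (h : R -> R) : BV01 w -> continuous h -> prim h 1 = 0 ->
  \int[leb]_(x in I01) (w x * h x) =
  - (\int[leb]_(x in I01) (prim h x * ac_density w x)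
     + charge_Rintegral (singular_part w) I01 (prim h)).
Proof.
move=> wBV hc h1; have [dw [ig _ dec]] := BV01_spec wBV.
rewrite (distr_derivative_prim wBV.1 dw hc h1); congr (- _).
have sc := prim_continuous hc.
have [C C0 hC] := continuous_bounded01 sc.
have phiC x : I01 x -> `|prim h x| <= C.
  by rewrite /= in_itv/= => /andP[x0 x1]; apply: hC; rewrite in_itv/= !ltW.
have ms := continuous_measurable_on (@measurable_I01 R) sc.
rewrite -(density_charge_Rintegral ig ms phiC).
apply: (charge_Rintegral_add (@measurable_I01 R) ms phiC) => A mA AI.
by rewrite dec// (density_chargeE ig).
Qed.

Lemma ae_eq_of_Rintegral_sqr (g : R -> R) : leb.-integrable I01 (EFin \o (fun x => g x ^+ 2)) ->
  \int[leb]_(x in I01) (g x ^+ 2) = 0 -> {ae leb, forall x, I01 x -> g x = 0}.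
Proof.
move=> ig E; have mI := @measurable_I01 R.
have fin := integrable_fin_num mI ig.
have e0 : (\int[leb]_(x in I01) (g x ^+ 2)%:E = 0)%E.
  by rewrite -[LHS]fineK//; congr EFin; exact: E.
have h : (\int[leb]_(x in I01) `|(g x ^+ 2)%:E| = 0)%E.
  rewrite -[RHS]e0; apply: eq_integral => x _; rewrite gee0_abs// lee_fin sqr_ge0//.
have /(ae_eq_integral_abs _ mI (measurable_int _ ig)) := h.
apply: filterS => x hx Ix; have := hx Ix => /= -[] /eqP.
by rewrite sqrf_eq0 => /eqP.
Qed.

End minim.

(** * The energy gap *)
Section final.
Context {R : realType}.
Local Notation leb := (@lebesgue_measure R).
Local Notation I01 := (`]0%R, 1%R[%classic : set R).
Local Notation TR := (measurableTypeR R).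
Implicit Types (mu nu : {charge set TR -> \bar R}) (A : set TR) (F f w u v p phi h : R -> R).

Lemma I01_sub x : I01 x -> x \in `[0, 1].
Proof. by rewrite /= !in_itv/= => /andP[/ltW -> /ltW ->]. Qed.

Lemma K_finite F f (lam c : R) w : (forall x, 0 <= F x) -> 0 < lam ->
  0 <= lambda_infty F ->
  (K F f lam w <= c%:E)%E ->
  [/\ (\int[leb]_(t in I01) (F (ac_density w t))%:E < +oo)%E,
     (\int[leb]_(t in I01) ((w t - f t) ^+ 2)%:E < +oo)%E &
     \int[leb]_(t in I01) (F (ac_density w t))
     + lambda_infty F * fine (total_var (singular_part w) I01)
     + lam / 2 * \int[leb]_(t in I01) ((w t - f t) ^+ 2) <= c].
Proof.
move=> F0 lam0 li0; rewrite /K /Rintegral.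
have mI := @measurable_I01 R.
have X0 : (0 <= \int[leb]_(t in I01) (F (ac_density w t))%:E)%E.
  by apply: integral_ge0 => x _; rewrite lee_fin.
have Y0 : (0 <= \int[leb]_(t in I01) ((w t - f t) ^+ 2)%:E)%E.
  by apply: integral_ge0 => x _; rewrite lee_fin sqr_ge0.
have : total_var (singular_part w) I01 \is a fin_num.
  by rewrite /total_var /charge_variation fin_numD !fin_num_measure.
move: X0 Y0; move: (integral _ _ _) => X; move: (integral _ _ _) => Y.
case: (total_var _ _) => [T| |]// + + _.
have l2 : 0 < lam / 2 by rewrite divr_gt0.
case: X => [X| |]//= X0; case: Y => [Y| |]//= Y0.
- by rewrite -!EFinM -!EFinD lee_fin => ->; rewrite !ltry.
- by rewrite gt0_muley// -EFinM -EFinD addey.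
- by rewrite gt0_muley// -EFinM addye// addye.
Qed.

(** The bookkeeping of the gap inequality: [Fp], [Fg] are the bulk energies of [v]
and [u], [Qv], [Qu] their fidelity terms, [sg], [sp], [c] the integrals of the dual
variable against the two densities and the singular part of [Du], [tv] the
singular energy of [u], and [E] is half of [lambda] times the squared distance. *)
Lemma energy_gap (Fp Fg sg sp c tv Qv Qu uh vh E : R) :
  Fp + (sg - sp) <= Fg -> c <= tv -> uh = - (sg + c) -> vh = - sp ->
  Qu = Qv + (uh - vh) + E -> Fg + tv + Qu <= Fp + Qv -> E <= 0.
Proof. lra. Qed.

(** [v] solves the Euler equation with dual variable [prim h = F'(v')]; comparing
energies gives [K u >= K v + lam / 2 * \int (u - v)^2]. *)
Lemma minimizer_eq F f (nu1 lam : R) u v dv p phi h :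
  (forall x, 0 <= F x) -> condF1 F -> condF2 F nu1 -> condF4 F -> 0 < lam ->
  continuous phi -> (forall t, t \in `[0, 1] -> phi t = f t) ->
  (forall x : R, is_derive x 1 v (dv x)) -> continuous dv -> continuous p ->
  (forall x, x \in `[0, 1] -> dv x = p x) ->
  (forall x, h x = lam * (v x - phi x)) -> prim h 1 = 0 ->
  (forall t, t \in `[0, 1] -> F^`()%classic (p t) = prim h t) ->
  BV01 u -> (K F f lam u <= K F f lam v)%E ->
  {ae leb, forall x, I01 x -> u x = v x}.
Proof.
move=> F0 F1 F2 F4 lam0 phic phiE vd dvc pc dvp hE h1 Fp uBV Kuv.
have mI := @measurable_I01 R.
have [Fd _] := condF1_derive F1.
have Fc : continuous F := is_derive_continuous Fd.
have vc : continuous v := is_derive_continuous vd.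
have hc : continuous h.
  have -> : h = fun x => lam * (v x - phi x) by exact/funext.
  by move=> x; apply: cvgM; [exact: cvg_cst|apply: cvgB; [exact: vc|exact: phic]].
have sc := prim_continuous hc.
have vBV := smooth_BV01 vd dvc.
have [acv tvv] := smooth_ac_singular vd dvc.
have [_ [igv _ _]] := BV01_spec vBV.
have [_ [ig _ _]] := BV01_spec uBV.
set g := ac_density u in ig; set nu := singular_part u.
have mF k : leb.-integrable I01 (EFin \o k) -> measurable_fun I01 (EFin \o (F \o k)).
  move=> ik; apply/measurable_EFinP; apply: measurableT_comp; first exact: continuous_measurable_fun.
  by apply/measurable_EFinP; exact: measurable_int ik.
have iFp : leb.-integrable I01 (EFin \o (F \o p)).
  by apply: continuous_integrable01 => x; exact: (continuous_comp (pc x) (Fc _)).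
have ivf : leb.-integrable I01 (EFin \o (fun x => (v x - phi x) ^+ 2)).
  apply: continuous_integrable01 => x.
  apply: (@cvg_comp _ _ _ (fun y => v y - phi y) (fun z => z ^+ 2)); last exact: exprn_continuous.
  by apply: cvgB; [exact: vc|exact: phic].
have fphi x : x \in I01 -> f x = phi x by move=> xI; rewrite phiE//; apply: I01_sub; rewrite inE in xI.
(* no singular part, and the chosen density is p almost everywhere *)
have Kv : K F f lam v = (\int[leb]_(t in I01) F (p t)
    + lam / 2 * \int[leb]_(t in I01) ((v t - phi t) ^+ 2))%:E.
  rewrite /K tvv mule0 adde0 EFinD (EFinM (lam / 2)) /Rintegral.
  rewrite fineK; last exact: (integrable_fin_num mI iFp).
  rewrite fineK; last exact: (integrable_fin_num mI ivf).
  congr (_ + _ * _)%E.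
    apply: ae_eq_integral => //.
    - exact: mF igv.
    - exact: measurable_int iFp.
    - by move: acv; apply: filterS => x hx Ix; rewrite hx// dvp//; exact: I01_sub.
  by apply: eq_integral => x xI; rewrite fphi.
have li0 : 0 <= lambda_infty F.
  by apply: le_trans (normr_derive1_le_lambda_infty 0 F1 F2 F4); exact: normr_ge0.
rewrite Kv in Kuv.
have [X Y main] := K_finite F0 lam0 li0 Kuv.
have mu_ : measurable_fun I01 u by apply/measurable_EFinP; exact: measurable_int uBV.1.
have iFg : leb.-integrable I01 (EFin \o (F \o g)).
  apply/integrableP; split; first exact: mF ig.
  by move: X; congr (_ < _)%E; apply: eq_integral => x _ /=; rewrite ger0_norm.
have Ef : \int[leb]_(t in I01) ((u t - f t) ^+ 2) = \int[leb]_(t in I01) ((u t - phi t) ^+ 2).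
  by apply: eq_Rintegral => x xI; rewrite fphi.
have iuf : leb.-integrable I01 (EFin \o (fun x => (u x - phi x) ^+ 2)).
  apply/integrableP; split.
    apply/measurable_EFinP; apply: measurable_funX; apply: measurable_funB => //.
    exact: continuous_measurable_on.
  move: Y; congr (_ < _)%E; apply: eq_integral => x xI /=.
  by rewrite ger0_norm ?sqr_ge0// fphi.
have bounded_mul (k b : R -> R) : continuous b -> leb.-integrable I01 (EFin \o k) ->
    leb.-integrable I01 (EFin \o (fun x => b x * k x)).
  move=> bc ik; have [C C0 hC] := continuous_bounded01 bc.
  have : leb.-integrable I01 ((EFin \o b) \* (EFin \o k))%E.
    apply: integrableMr => //; first exact: continuous_measurable_on.
    exists C; split; first exact: num_real.
    by move=> y Cy x Ix; rewrite /= (le_trans (hC x (I01_sub Ix)))// ltW.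
  by congr (integrable _ _ _).
have isg : leb.-integrable I01 (EFin \o (fun x => prim h x * g x)) by exact: bounded_mul.
have isp : leb.-integrable I01 (EFin \o (fun x => prim h x * p x)).
  by apply: bounded_mul => //; exact: continuous_integrable01.
have iuh : leb.-integrable I01 (EFin \o (fun x => h x * u x)) by apply: bounded_mul => //; exact: uBV.1.
have ivh : leb.-integrable I01 (EFin \o (fun x => h x * v x)).
  by apply: bounded_mul => //; exact: vBV.1.
have iB k1 k2 : leb.-integrable I01 (EFin \o k1) -> leb.-integrable I01 (EFin \o k2) ->
  leb.-integrable I01 (EFin \o (fun x => k1 x - k2 x)).
  by move=> i1 i2; have := integrableB mI i1 i2; congr (integrable _ _ _).
have iD k1 k2 : leb.-integrable I01 (EFin \o k1) -> leb.-integrable I01 (EFin \o k2) ->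
  leb.-integrable I01 (EFin \o (fun x => k1 x + k2 x)).
  by move=> i1 i2; have := integrableD mI i1 i2; congr (integrable _ _ _).
have iZ (c : R) k1 : leb.-integrable I01 (EFin \o k1) ->
  leb.-integrable I01 (EFin \o (fun x => c * k1 x)).
  by move=> i1; have := integrableZl mI c i1; congr (integrable _ _ _).
(* tangent inequality for F at p, integrated *)
have R1 : \int[leb]_(x in I01) F (p x) + (\int[leb]_(x in I01) (prim h x * g x)
     - \int[leb]_(x in I01) (prim h x * p x)) <= \int[leb]_(x in I01) F (g x).
  rewrite -RintegralB// -RintegralD//; last exact: iB.
  apply: le_Rintegral => //; first by apply: iD => //; exact: iB.
  move=> x Ix; rewrite -mulrBr -Fp; last exact: I01_sub.
  exact: condF_tangent_le.
(* both derivatives are tested with the dual variable *)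
have R2 := BV01_integral_prim uBV hc h1.
have R3 : \int[leb]_(x in I01) (v x * h x) = - \int[leb]_(x in I01) (prim h x * p x).
  have idv := continuous_integrable01 dvc.
  rewrite (distr_derivative_prim vBV.1 (smooth_distr_derivative idv vd dvc) hc h1).
  have [C C0 hC] := continuous_bounded01 sc.
  rewrite (density_charge_Rintegral idv (continuous_measurable_on mI sc)
    (fun x Ix => hC x (I01_sub Ix))).
  congr (- _); apply: eq_Rintegral => x; rewrite inE => Ix.
  by rewrite dvp//; exact: I01_sub.
(* the slope at infinity dominates the dual variable *)
have c_le : charge_Rintegral nu I01 (prim h) <= lambda_infty F * fine (total_var nu I01).
  apply: charge_Rintegral_le_total_var => //; first exact: continuous_measurable_on.
  move=> x Ix; rewrite -Fp; last exact: I01_sub.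
  exact: normr_derive1_le_lambda_infty F1 F2 F4.
(* u is only known to be integrable, but K u is finite *)
have ie : leb.-integrable I01 (EFin \o (fun x => (u x - v x) ^+ 2)).
  have -> : (fun x => (u x - v x) ^+ 2) =
      (fun x => (u x - phi x) ^+ 2 - (v x - phi x) ^+ 2 - 2 / lam * (h x * u x - h x * v x)).
    by apply/funext => x; rewrite hE; field; rewrite gt_eqF.
  by apply: (iB); [exact: iB|apply: iZ; exact: iB].
have R4 : lam / 2 * \int[leb]_(t in I01) ((u t - phi t) ^+ 2) =
   lam / 2 * \int[leb]_(t in I01) ((v t - phi t) ^+ 2)
   + (\int[leb]_(t in I01) (h t * u t) - \int[leb]_(t in I01) (h t * v t))
   + lam / 2 * \int[leb]_(t in I01) ((u t - v t) ^+ 2).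
  rewrite -!RintegralZl// -RintegralB// -RintegralD//; [|exact: iZ|exact: iB].
  rewrite -RintegralD//; [|by apply: iD; [exact: iZ|exact: iB]|exact: iZ].
  by apply: eq_Rintegral => x _; rewrite hE; field.
have E0 : \int[leb]_(t in I01) ((u t - v t) ^+ 2) = 0.
  have uh : \int[leb]_(x in I01) (h x * u x) = \int[leb]_(x in I01) (u x * h x).
    by apply: eq_Rintegral => x _; rewrite mulrC.
  have vh : \int[leb]_(x in I01) (h x * v x) = \int[leb]_(x in I01) (v x * h x).
    by apply: eq_Rintegral => x _; rewrite mulrC.
  have E_ge0 : 0 <= \int[leb]_(t in I01) ((u t - v t) ^+ 2).
    by apply: Rintegral_ge0 => x _; exact: sqr_ge0.
  rewrite Ef in main; rewrite uh vh in R4.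
  have l2 : 0 < lam / 2 by rewrite divr_gt0.
  apply/eqP; rewrite eq_le E_ge0 andbT -(pmulr_rle0 _ l2).
  exact: (energy_gap R1 c_le R2 R3 R4 main).
have := ae_eq_of_Rintegral_sqr ie E0.
apply: filterS; first exact: (ae_filter_ringOfSetsType leb).
by move=> x hx Ix; apply/subr0_eq; exact: hx.
Qed.

End final.

(** * Good representatives *)
Section representative.
Context {R : realType}.
Local Notation leb := (@lebesgue_measure R).
Local Notation I01 := (`]0%R, 1%R[%classic : set R).
Implicit Types (u v w : R -> R) (x y a b l : R).

Lemma ae_itv_witness (P : R -> Prop) a b : a < b ->
  {ae leb, forall x, I01 x -> P x} -> 0 <= a -> b <= 1 ->
  exists2 y, a < y < b & P y.
Proof.
move=> ab aeP a0 b1; apply: contrapT => nex.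
have : leb.-negligible `]a, b[%classic.
  apply: negligibleS aeP => y /=; rewrite in_itv/= => yab h.
  apply: nex; exists y => //; apply: h; rewrite /= in_itv/=.
  by move: yab => /andP[ay yb]; rewrite (le_lt_trans a0 ay) (lt_le_trans yb b1).
move=> neg; have leb0 : leb (`]a, b[%classic : set R) = 0%E.
  by apply: measure_negligible => //; exact: measurable_itv.
have := lebesgue_measure_itv `]a, b[; rewrite [LHS]leb0/= lte_fin ab -EFinB => -[] /esym/eqP.
by rewrite subr_eq0 gt_eqF.
Qed.

(** Two functions that agree at points arbitrarily far in a filter have the same
limit. *)
Lemma frequently_lim_eq {Fl : set_system R} {FF : ProperFilter Fl} u v l (c : R) :
  (forall P : set R, Fl P -> exists2 y, P y & u y = v y) ->
  u y @[y --> Fl] --> l -> v y @[y --> Fl] --> c -> l = c.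
Proof.
move=> freq ul vc; apply: contrapT => /eqP lc.
have h : u y - v y @[y --> Fl] --> l - c by exact: cvgB.
have : \forall y \near Fl, u y - v y != 0.
  by apply: (cvgr_neq0 _ h); rewrite subr_eq0.
by move=> /freq[y + uv]; rewrite uv subrr eqxx.
Qed.

Lemma ae_eq_lim_right u v x l : {ae leb, forall x, I01 x -> u x = v x} ->
  0 <= x < 1 -> u y @[y --> x^'+] --> l -> {for x, continuous v} -> l = v x.
Proof.
move=> ae /andP[x0 x1] ul vx.
apply: (@frequently_lim_eq _ _ u v l (v x) _ ul); last exact: cvg_at_right_filter.
move=> P [d /= d0 dP].
have xm : x < Num.min (x + d) 1 by rewrite lt_min ltrDl d0 x1.
have [|y /andP[xy]] := ae_itv_witness xm ae x0; first by rewrite ge_min lexx orbT.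
rewrite lt_min => /andP[yd _] uv; exists y => //; apply: dP => //=.
by rewrite distrC gtr0_norm ?subr_gt0// ltrBlDl.
Qed.

Lemma ae_eq_lim_left u v x l : {ae leb, forall x, I01 x -> u x = v x} ->
  0 < x <= 1 -> u y @[y --> x^'-] --> l -> {for x, continuous v} -> l = v x.
Proof.
move=> ae /andP[x0 x1] ul vx.
apply: (@frequently_lim_eq _ _ u v l (v x) _ ul); last exact: cvg_at_left_filter.
move=> P [d /= d0 dP].
have xm : Num.max (x - d) 0 < x by rewrite gt_max gtrBl d0 x0.
have [|y /andP[]] := ae_itv_witness xm ae _ x1; first by rewrite le_max lexx orbT.
rewrite gt_max => /andP[yd _] yx uv; exists y => //; apply: dP => //=.
by rewrite gtr0_norm ?subr_gt0// ltrBlDr -ltrBlDl.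
Qed.

(** One-sided limits see only values off a null set, so those of [u] are values of
[v]. They agree at every interior point, where [u] thus has no jump, and a good
representative has no other discontinuities. *)
Lemma good_representative_eq u v : good_representative u -> continuous v ->
  {ae leb, forall x, I01 x -> u x = v x} ->
  forall x, x \in `[0, 1] -> u x = v x.
Proof.
move=> [lr u0 u1 _ jump] vc ae x; rewrite in_itv/= => /andP[x0 x1].
have [->|xn0] := eqVneq x 0.
  by apply: (ae_eq_lim_right ae _ u0); [rewrite lexx ltr01|exact: vc].
have [->|xn1] := eqVneq x 1.
  by apply: (ae_eq_lim_left ae _ u1); [rewrite lexx ltr01|exact: vc].
have x0' : 0 < x by rewrite lt_neqAle eq_sym xn0.
have x1' : x < 1 by rewrite lt_neqAle xn1.
have Ix : I01 x by rewrite /= in_itv/= x0'.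
have [cl cr] := lr x Ix.
have eL : lim (u y @[y --> x^'-]) = v x.
  by apply: (ae_eq_lim_left ae _ cl); [rewrite x0'|exact: vc].
have eR : lim (u y @[y --> x^'+]) = v x.
  by apply: (ae_eq_lim_right ae _ cr); [rewrite x0|exact: vc].
have uc : {for x, continuous u}.
  by apply: contrapT => /(jump x Ix); rewrite eL eR.
apply: (ae_eq_lim_right ae (l := u x)); [by rewrite x0|exact: cvg_at_right_filter|exact: vc].
Qed.

Lemma C2_on_01_eq u v : (forall x, x \in `[0, 1] -> u x = v x) ->
  C2_on_01 v -> C2_on_01 u.
Proof.
move=> uv [w1 [w2 [d1 d2 c2]]]; exists w1, w2; split => // x x01.
apply: cvg_trans (d1 x x01); apply: near_eq_cvg.
near=> y.
have y01 : y \in `[0, 1] by near: y; exact: withinT.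
by rewrite !uv.
Unshelve. all: by end_near. Qed.

End representative.

Unset Implicit Arguments.

Theorem corollary1p1 (R : realType) (F f u : R -> R)
    (nu1 nu2 nu3 lambda : R)
    (F_ge0 : forall p, 0 <= F p)
    (nu1_gt0 : 0 < nu1) (nu2_gt0 : 0 < nu2)
    (F1 : condF1 F) (F2 : condF2 F nu1) (F3 : condF3 F nu2 nu3) (F4 : condF4 F)
    (f01 : forall t, t \in `[0, 1] -> 0 <= f t <= 1)
    (lambda_gt0 : 0 < lambda)
    (u_min : minimizer_BV01 F f lambda u)
    (u_good : good_representative u)
    (f_lip : [lipschitz f t | t in `[0, 1]%classic]) :
  C2_on_01 u.
Proof.
have [a [p [phi [phic pc phiE [h1 Fp vC2]]]]] := euler_bvp F1 F4 lambda_gt0 f01 f_lip.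
pose v t := a + prim p t.
have vd : forall x : R, is_derive x 1 v (plateau x * p x) := is_derive_add_prim a pc.
have dvc : continuous (fun x => plateau x * p x).
  by move=> x; apply: cvgM; [exact: plateau_continuous|exact: pc].
have dvp x : x \in `[0, 1] -> plateau x * p x = p x.
  by move=> x01; rewrite plateau1// mul1r.
have [uBV umin] := u_min.
have Kuv := umin v (smooth_BV01 vd dvc).
have ae := minimizer_eq F_ge0 F1 F2 F4 lambda_gt0 phic phiE vd dvc pc dvp
  (fun x => erefl (lambda * (v x - phi x))) h1 Fp uBV Kuv.
apply: (C2_on_01_eq _ vC2).
exact: good_representative_eq u_good (is_derive_continuous vd) ae.
Qed.
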